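(* Let $n\geq 3$ and let $G\in\mathcal{G}_{2n}$ with $F(G)=n-1$. Then $G$ is $1$-extendable but not $2$-extendable if and only if $G$ has a perfect matching $M=\{u_iv_i : i=1,\dots,n\}$ with $f(G,M)=n-1$ such that one of the following holds: (i) $n\geq 4$, the induced subgraph $G[\{v_1,\dots,v_n\}]$ is the disjoint union of one triangle and $n-3$ isolated vertices, and $G[\{u_1,\dots,u_n\}]$ contains at least two independent (disjoint) edges; (ii) $\{v_1,\dots,v_{n-1}\}$ is an independent set of $G$, $G[\{u_1,\dots,u_n,v_n\}]$ contains at least two independent edges, and $\{v_iv_n,\ v_ju_n\}\subseteq E(G)$ for some $i,j$ with $1\leq i,j\leq n-1$.
   Context: All graphs are finite and simple. $\mathcal{G}_{2n}$ denotes the set of all graphs with $2n$ vertices that have a perfect matching. For a perfect matching $M$ of $G$, a forcing set of $M$ is a subset $S\subseteq M$ contained in no other perfect matching of $G$; $f(G,M)$ is the minimum size of a forcing set of $M$, and $F(G)$ is the maximum of $f(G,M)$ over all perfect matchings $M$. For an integer $l\ge 0$, a connected graph with at least $2l+2$ vertices is $l$-extendable if it has a perfect matching and every matching of size $l$ is contained in a perfect matching. *)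

(* Defs.v *)
(* Simple graphs: e : rel T on a finType T, symmetric and irreflexive. *)
From mathcomp Require Import all_boot.
Set Implicit Arguments. Unset Strict Implicit. Unset Printing Implicit Defensive.

Section Graphs.
Variable T : finType.
Variable e : rel T.

Definition is_edge (A : {set T}) : bool :=
  [exists x : T, exists y : T, e x y && (A == [set x; y])].

Definition matching (M : {set {set T}}) : bool :=
  [forall A in M, is_edge A] &&
  [forall A in M, forall B in M, (A != B) ==> [disjoint A & B]].

Definition perfect_matching (M : {set {set T}}) : bool :=
  matching M && (cover M == [set: T]).

Definition has_perfect_matching : bool :=
  [exists M : {set {set T}}, perfect_matching M].

Definition forcing (M S : {set {set T}}) : bool :=
  (S \subset M) &&
  [forall M' : {set {set T}}, (perfect_matching M' && (S \subset M')) ==> (M' == M)].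

(* f(G,M): minimum size of a forcing set of M (M itself is forcing, and
   #|M| <= #|T|, so the neutral element #|T| does not affect the value). *)
Definition fnum (M : {set {set T}}) : nat :=
  \big[minn/#|T|]_(S : {set {set T}} | forcing M S) #|S|.

Definition Fnum : nat :=
  \max_(M : {set {set T}} | perfect_matching M) fnum M.

Definition connected_graph : bool := [forall x : T, forall y : T, connect e x y].

Definition extendable (l : nat) : bool :=
  [&& connected_graph, 2 * l + 2 <= #|T|, has_perfect_matching &
   [forall M : {set {set T}}, (matching M && (#|M| == l)) ==>
      [exists M' : {set {set T}}, perfect_matching M' && (M \subset M')]]].

Definition two_indep_edges (W : {set T}) : Prop :=
  exists x1 y1 x2 y2 : T,
    [/\ [&& x1 \in W, y1 \in W, x2 \in W & y2 \in W],
        e x1 y1, e x2 y2 & [disjoint [set x1; y1] & [set x2; y2]]].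

End Graphs.

(* Main.v *)
(** Let [s] be the partner map of a perfect matching [M].  The equality
    f(G,M) = n - 1 says that any two edges of [M] span an alternating 4-cycle,
    i.e. any two edges of [M] can be re-matched in at least one of the two
    possible ways.  If disjoint edges ab, cd lie in no perfect matching, let Y
    be the set of partners of a, b, c, d lying outside {a, b, c, d}; it has two
    or four elements (if it were empty, [M] could be re-matched inside
    {a, b, c, d}).  If Y = {y, z}, every further edge of [M] must have one
    end adjacent to both y and z and the other end adjacent to neither, and
    the latter ends form with Y an independent set, which gives (ii).  If
    |Y| = 4, repeated use of the two-element case produces a set V of
    representatives of the edges of [M] that contains Y and has no two
    disjoint edges; the edges inside V then form a star or a triangle, which
    is (ii) or (i).  1-extendability is what excludes an independent V.
    Conversely, in (i) and (ii) two independent edges on the side opposite to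
    V leave too few partners for V, while an edge that does not extend would
    produce an independent set of representatives of the edges of [M], which
    the vertices listed in (i) and (ii) exclude. *)
Require Import Defs.
From mathcomp Require Import all_boot zify.
Set Implicit Arguments. Unset Strict Implicit. Unset Printing Implicit Defensive.

(** * Perfect matchings as involutions, and matchings coded by lists *)

Section MatchingBasics.
Variables (T : finType) (e : rel T).
Hypotheses (e_sym : symmetric e) (eirr : irreflexive e).

Lemma edge_neq x y : e x y -> x != y.
Proof. by apply: contraTneq => ->; rewrite eirr. Qed.

Lemma is_edgeP A : reflect (exists x y, e x y /\ A = [set x; y]) (is_edge e A).
Proof.
apply: (iffP existsP) => [[x /existsP[y /andP[exy /eqP->]]]|[x [y [exy ->]]]].
  by exists x, y.
by exists x; apply/existsP; exists y; rewrite exy eqxx.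
Qed.

Lemma matchingP (M : {set {set T}}) :
  reflect ({in M, forall A, is_edge e A} /\
           {in M &, forall A B : {set T}, A != B -> [disjoint A & B]})
          (matching e M).
Proof.
apply: (iffP andP) => -[ME MD]; split.
- by move=> A AM; move/forall_inP: ME => /(_ A AM).
- move=> A B AM BM; move/forall_inP: MD => /(_ A AM)/forall_inP/(_ B BM).
  by move/implyP.
- by apply/forall_inP.
- by apply/forall_inP=> A AM; apply/forall_inP=> B BM; apply/implyP; apply: MD.
Qed.

(** Covering gives every vertex a partner and disjointness makes it unique. From here on a perfect
    matching is handled through the involution [s] and no longer as a set of sets. *)
Lemma perfect_matching_partner (M : {set {set T}}) : perfect_matching e M ->
  exists s : T -> T, [/\ involutive s, forall x, e x (s x),
    forall x y, ([set x; y] \in M) = (y == s x) & M = [set [set x; s x] | x : T]].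
Proof.
case/andP=> /matchingP[ME MD] /eqP cM.
have ex x : exists y, (e x y) && ([set x; y] \in M).
  have : x \in cover M by rewrite cM inE.
  case/bigcupP=> A AM; have /is_edgeP[a [b [eab Aab]]] := ME A AM.
  rewrite Aab in AM *; rewrite !inE => /orP[] /eqP->; first by exists b; rewrite eab.
  by exists a; rewrite e_sym eab setUC.
pose s x := xchoose (ex x).
have sP x : e x (s x) && ([set x; s x] \in M) := xchooseP (ex x).
have es x : e x (s x) by case/andP: (sP x).
have Ms x : [set x; s x] \in M by case/andP: (sP x).
have uniqs x y : [set x; y] \in M -> y = s x.
  move=> Mxy; have [xy|nxy] := eqVneq [set x; y] [set x; s x].
    have : s x \in [set x; y] by rewrite xy !inE eqxx orbT.
    by rewrite !inE eq_sym (negPf (edge_neq (es x))) => /eqP.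
  have /pred0P/(_ x) := MD _ _ Mxy (Ms x) nxy.
  by rewrite /= !inE eqxx.
exists s; split=> //.
- by move=> x; apply/esym/uniqs; rewrite setUC.
- by move=> x y; apply/idP/eqP => [|->]; [apply: uniqs | apply: Ms].
- apply/setP=> A; apply/idP/imsetP => [AM|[x _ ->] //].
  have /is_edgeP[a [b [_ Aab]]] := ME A AM.
  by exists a; rewrite // Aab; congr [set _; _]; apply: uniqs; rewrite -Aab.
Qed.

Lemma card_perfect_matching M : perfect_matching e M -> #|T| = 2 * #|M|.
Proof.
case/andP=> /matchingP[ME MD] /eqP cM.
have tM : trivIset M by apply/trivIsetP=> A B AM BM; apply: MD.
have pM : partition M [set: T].
  rewrite /partition cM eqxx tM /=; apply/negP=> /ME/is_edgeP[a [b [_]]].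
  by move/setP/(_ a); rewrite !inE eqxx.
rewrite -cardsT (card_uniform_partition _ pM (n := 2)) 1?mulnC // => A AM.
by have /is_edgeP[a [b [eab ->]]] := ME A AM; rewrite cards2 edge_neq.
Qed.

(* A matching is coded by the list [:: x1; y1; x2; y2; ...] of its matched
   vertices. *)
Fixpoint paired (L : seq T) : bool :=
  match L with
  | [::] => true
  | [:: x] => false
  | x :: y :: L' => e x y && paired L'
  end.

Fixpoint pairsets (L : seq T) : seq {set T} :=
  match L with
  | x :: y :: L' => [set x; y] :: pairsets L'
  | _ => [::]
  end.

Lemma paired_ind (P : seq T -> Prop) :
  P [::] -> (forall x y L, e x y -> paired L -> P L -> P [:: x, y & L]) ->
  forall L, paired L -> P L.
Proof.
move=> P0 PS L; have [n] := ubnP (size L).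
elim: n L => // n IHn [|x [|y L]] //= szL /andP[exy pL].
by apply: PS => //; apply: IHn => //; lia.
Qed.

Lemma paired_cat L1 L2 : paired L1 -> paired (L1 ++ L2) = paired L2.
Proof. by move=> p1; elim/paired_ind: L1 / p1 => //= x y L -> _ ->. Qed.

Lemma mem_pairsets L x :
  paired L -> (x \in L) = has (fun A : {set T} => x \in A) (pairsets L).
Proof.
move=> pL; elim/paired_ind: L / pL => //= a b L _ _ IH.
by rewrite !inE IH orbA.
Qed.

Lemma pairsets_matching L : paired L -> uniq L -> matching e [set A in pairsets L].
Proof.
move=> pL; elim/paired_ind: L / pL => [_|a b L eab pL IH] /=.
  by apply/matchingP; split=> A; rewrite inE.
case/and3P; rewrite inE negb_or => /andP[nab aL] bL uL.
have /matchingP[ME MD] := IH uL.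
have dis A : A \in pairsets L -> [disjoint [set a; b] & A].
  move=> AL; rewrite disjoint_subset; apply/subsetP=> x.
  rewrite !inE => /orP[]/eqP->; apply: contra (aL) => // xA; last first.
    by case/negP: bL; rewrite mem_pairsets //; apply/hasP; exists A.
  by rewrite mem_pairsets //; apply/hasP; exists A.
apply/matchingP; split=> [A|A B]; rewrite !inE.
  case/orP=> [/eqP->|AL]; last by apply: ME; rewrite inE.
  by apply/is_edgeP; exists a, b.
case/orP=> [/eqP->|AL]; case/orP=> [/eqP->|BL]; rewrite ?eqxx // => nAB.
- exact: dis.
- by rewrite disjoint_sym; apply: dis.
- by apply: MD; rewrite ?inE.
Qed.

Lemma pairsets_perfect L : paired L -> uniq L -> (forall x, x \in L) ->
  perfect_matching e [set A in pairsets L].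
Proof.
move=> pL uL aL; rewrite /perfect_matching pairsets_matching //=.
apply/eqP/setP=> x; rewrite inE; have := aL x; rewrite mem_pairsets //.
by case/hasP=> A AL xA; apply/bigcupP; exists A; rewrite ?inE.
Qed.

Lemma matching1P M : matching e M -> #|M| = 1 ->
  exists a b, [/\ M = [set [set a; b]], e a b & uniq [:: a; b]].
Proof.
move=> /matchingP[ME _] /eqP/cards1P[A MA].
have /is_edgeP[a [b [eab Aab]]] : is_edge e A by apply: ME; rewrite MA set11.
by exists a, b; rewrite MA Aab eab /= inE edge_neq.
Qed.

Lemma matching2P M : matching e M -> #|M| = 2 -> exists a b c d,
  [/\ M = [set [set a; b]; [set c; d]], e a b, e c d & uniq [:: a; b; c; d]].
Proof.
move=> /matchingP[ME MD] /eqP/cards2P[A [B [nAB MAB]]].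
have AM : A \in M by rewrite MAB set21.
have BM : B \in M by rewrite MAB set22.
have /is_edgeP[a [b [eab Aab]]] := ME _ AM.
have /is_edgeP[c [d [ecd Bcd]]] := ME _ BM.
have := MD _ _ AM BM nAB; rewrite Aab Bcd disjoint_subset => /subsetP dis.
exists a, b, c, d; rewrite eab ecd MAB Aab Bcd; split=> //=.
have := dis a; have := dis b; rewrite !inE !eqxx orbT => /(_ isT) -> /(_ isT).
by move/negPf=> nacd; rewrite nacd orbF !edge_neq.
Qed.

Lemma disjoint_set2 (a b c d : T) :
  [disjoint [set a; b] & [set c; d]] = (a \notin [:: c; d]) && (b \notin [:: c; d]).
Proof.
apply/pred0P/andP => [dis|[ac bc] x].
  have := dis a; have := dis b.
  by rewrite /= !inE !eqxx orbT /= => /negbT ? /negbT ?.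
rewrite /= !inE in ac bc *.
by case: eqP => [->|_]; [exact: negPf | case: eqP => // ->; exact: negPf].
Qed.

Lemma two_indepP W : two_indep_edges e W <-> exists a b c d,
  [/\ {subset [:: a; b; c; d] <= W}, e a b, e c d & uniq [:: a; b; c; d]].
Proof.
split=> [[a [b [c [d [abcd eab ecd dis]]]]]|[a [b [c [d [sub eab ecd un]]]]]];
  exists a, b, c, d; split=> //.
- by move=> x; case/and4P: abcd => aW bW cW dW; rewrite !inE => /or4P[] /eqP->.
- move: dis; rewrite disjoint_set2 /= !inE !negb_or.
  by case/andP=> /andP[-> ->] /andP[-> ->]; rewrite !edge_neq.
- by apply/and4P; split; apply: sub; rewrite !inE eqxx ?orbT.
- move: un; rewrite disjoint_set2 /= !inE !negb_or.
  by case/and4P=> /and3P[_ -> ->] /andP[-> ->].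
Qed.

Lemma two_indep_matching a b c d : e a b -> e c d -> uniq [:: a; b; c; d] ->
  matching e [set [set a; b]; [set c; d]] /\ #|[set [set a; b]; [set c; d]]| = 2.
Proof.
move=> eab ecd un; split.
  have := @pairsets_matching [:: a; b; c; d]; rewrite /= eab ecd => /(_ isT un).
  by congr matching; apply/setP=> A; rewrite !inE.
rewrite cards2; case: eqP => // /setP/(_ a).
move: un; rewrite /= !inE eqxx !negb_or => /andP[/and3P[_]].
by move=> /negPf-> /negPf->.
Qed.

End MatchingBasics.

(** * Sub-matchings of a fixed perfect matching, given by representatives *)

Section Dense.
Variables (T : finType) (e : rel T) (s : T -> T).
Hypotheses (e_sym : symmetric e) (e_irr : irreflexive e).
Hypotheses (sK : involutive s) (es : forall x, e x (s x)).

(** The code of the sub-matching formed by the edges at the vertices of [rs]. Consequently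
    [uniq (canon rs)] says that the vertices of [rs] lie on distinct edges. *)
Definition canon (rs : seq T) : seq T := flatten [seq [:: r; s r] | r <- rs].

Lemma s_neq x : (s x == x) = false.
Proof. by apply/negbTE; rewrite eq_sym (edge_neq e_irr). Qed.

Lemma s_eq x y : (s x == s y) = (x == y).
Proof. exact: (inj_eq (inv_inj sK)). Qed.

Lemma s_eqC x y : (s x == y) = (x == s y).
Proof. by rewrite -{1}[y]sK s_eq. Qed.

Lemma canon_cons r rs : canon (r :: rs) = [:: r, s r & canon rs].
Proof. by []. Qed.

Lemma canon_cat rs rs' : canon (rs ++ rs') = canon rs ++ canon rs'.
Proof. by rewrite /canon map_cat flatten_cat. Qed.

Lemma perm_canon rs rs' : perm_eq rs rs' -> perm_eq (canon rs) (canon rs').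
Proof. by move=> rsP; apply/perm_flatten/perm_map. Qed.

Lemma mem_canon_s x rs : (s x \in canon rs) = (x \in canon rs).
Proof.
elim: rs => // r rs IH; rewrite canon_cons !inE IH s_eq s_eqC.
by rewrite orbCA.
Qed.

Lemma mem_canon x rs : (x \in canon rs) = (x \in rs) || (s x \in rs).
Proof.
elim: rs => // r rs IH; rewrite canon_cons !inE IH s_eqC.
by rewrite -!orbA; congr (_ || _); rewrite orbCA.
Qed.

Lemma uniq_canon_cons r rs :
  uniq (canon (r :: rs)) = (r \notin canon rs) && uniq (canon rs).
Proof. by rewrite canon_cons /= inE eq_sym s_neq mem_canon_s /=; case: (r \in _). Qed.

Lemma uniq_canon_uniq rs : uniq (canon rs) -> uniq rs.
Proof.
elim: rs => // r rs IH; rewrite uniq_canon_cons mem_canon negb_or cons_uniq.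
by case/andP=> /andP[-> _] /IH.
Qed.

Lemma paired_canon rs : paired e (canon rs).
Proof. by elim: rs => //= r rs; rewrite es. Qed.

(** Greedy: as long as some vertex is uncovered, its edge is new and can be added; the number of
    vertices bounds the process. *)
Lemma canon_complete l : uniq (canon l) ->
  exists l', uniq (canon (l' ++ l)) /\ forall x, x \in canon (l' ++ l).
Proof.
have [t tE] : exists t, t = #|T| by exists #|T|.
have [k] := ubnP (t - size (canon l)).
elim: k l => // k IH l szl ul.
have [/forallP al|/forallPn[x xl]] := boolP [forall x, x \in canon l].
  by exists [::].
have uxl : uniq (canon (x :: l)) by rewrite uniq_canon_cons xl.
have szx : size (canon (x :: l)) <= t.
  by rewrite tE -(card_uniqP uxl) max_card.
case: (IH (x :: l)) => //; first by move: szx; rewrite canon_cons /=; lia.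
by move=> l'; rewrite -cat_rcons => ?; exists (rcons l' x).
Qed.

(* With [D] the edges of the matching that are already dealt with, no
   matching covers exactly [ys] and the ends of some further edges [rs]. *)
Definition unmatchable (D ys : seq T) := forall rs L,
  uniq (canon (rs ++ ys ++ D)) -> perm_eq L (ys ++ canon rs) -> paired e L -> False.

Lemma unmatchable_perm D ys ys' :
  perm_eq ys ys' -> unmatchable D ys -> unmatchable D ys'.
Proof.
move=> yP N rs L u LP; apply: (N rs).
  rewrite -(perm_uniq (_ : perm_eq (canon (rs ++ ys' ++ D)) _)) //.
  by apply: perm_canon; rewrite perm_cat2l perm_cat2r perm_sym.
by rewrite (perm_trans LP) // perm_cat2r perm_sym.
Qed.

(** [X] codes the edges that do not extend; [D] represents the edges with both ends in [X], and [ys]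
    lists the partners of vertices of [X] that lie outside [X]. A forbidden [L], together with [X]
    and the original edges on all remaining vertices, would be a perfect matching through [X]. *)
Lemma nonext_unmatchable D ys X : uniq (canon (ys ++ D)) ->
  perm_eq (X ++ ys) (canon (ys ++ D)) -> paired e X ->
  (forall L, paired e (X ++ L) -> uniq (X ++ L) -> (forall x, x \in X ++ L) -> False) ->
  unmatchable D ys.
Proof.
move=> uD XP pX NE rs L u LP pL.
have [l' [ul' al']] := canon_complete u.
have P : perm_eq (X ++ L ++ canon l') (canon (l' ++ rs ++ ys ++ D)).
  apply/permP => P; move/permP/(_ P): XP; move/permP/(_ P): LP.
  rewrite !canon_cat !count_cat; lia.
apply: (NE (L ++ canon l')); first by rewrite !paired_cat // paired_canon.
  by rewrite (perm_uniq P).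
by move=> x; rewrite (perm_mem P).
Qed.

(** * Alternating 4-cycles and half sets *)

Hypothesis link : forall x y, x != y -> x != s y ->
  (e x y && e (s x) (s y)) || (e x (s y) && e (s x) y).

Lemma link_or x y : x != y -> x != s y -> e x y || e x (s y).
Proof. by move=> xy xsy; case/orP: (link xy xsy) => /andP[->]; rewrite ?orbT. Qed.

(** A transversal of the matching: exactly one end of each edge. *)
Definition half_set (V : {set T}) := forall x, (s x \in V) = (x \notin V).
Definition independent (V : {set T}) := {in V &, forall x y, ~~ e x y}.

(** The edges represented in [D] contribute the listed end; on every other edge [P] decides, and it
    holds at exactly one end. *)
Lemma half_set_sel D (P : pred T) : uniq (canon D) ->
  (forall x, x \notin canon D -> P (s x) = ~~ P x) ->
  half_set [set x | (x \in D) || (x \notin canon D) && P x].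
Proof.
move=> uD PD x; rewrite !inE mem_canon_s.
have [xD|xD] /= := boolP (x \in canon D); last first.
  rewrite PD //; move: (xD); rewrite mem_canon negb_or => /andP[xD1 xD2].
  by rewrite (negPf xD1) (negPf xD2).
rewrite !orbF; elim: D uD xD {PD} => // r D IH.
rewrite uniq_canon_cons => /andP[]; rewrite {1}mem_canon negb_or => /andP[rD srD] uD.
rewrite canon_cons !inE => /or3P[/eqP->|/eqP->|xD].
- by rewrite s_neq eqxx (negPf srD).
- by rewrite sK s_neq eqxx (negPf srD) (negPf rD).
- have [xr|_] := eqVneq x r; first by move: xD; rewrite xr mem_canon (negPf rD) (negPf srD).
  have [xr|_] := eqVneq (s x) r; last exact: IH.
  by move: xD; rewrite -mem_canon_s xr mem_canon (negPf rD) (negPf srD).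
Qed.

(* [lia] case-splits on every coerced boolean unless these are abstracted. *)
Ltac abstract_counts := repeat match goal with
  | |- context [nat_of_bool (?P ?x)] => generalize (nat_of_bool (P x))
  | |- context [@count ?A ?P ?l] => generalize (@count A P l)
  end; clear; lia.

Ltac perm_count := apply/permP => ?; rewrite /= ?sK ?count_cat /=; abstract_counts.

Ltac perm_count_from LP :=
  let P := fresh "P" in
  apply/permP => P; move/permP/(_ P): LP; rewrite /canon /= ?sK ?count_cat /=; abstract_counts.

(** * Two vertices left over *)

Section TwoLeft.
Variables (D : seq T) (y z : T).
Hypotheses (uD : uniq (canon ([:: y; z] ++ D))) (N : unmatchable D [:: y; z]).

Lemma two_left_neq r : r \notin canon ([:: y; z] ++ D) ->
  [/\ y != r, y != s r, z != r & z != s r].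
Proof.
rewrite !canon_cons !inE !negb_or !(eq_sym y) !(eq_sym z) !s_eqC.
by case/and5P=> -> -> -> ->.
Qed.

(** Matching [y] and [z] to opposite ends of the edge at [r] is forbidden, while [link] lets each of
    them see at least one end. Hence both see exactly one end, and the same one. *)
Lemma two_left r : r \notin canon ([:: y; z] ++ D) ->
  e z r = e y r /\ e y (s r) = ~~ e y r.
Proof.
move=> rD; have [yr ysr zr zsr] := two_left_neq rD.
have ur : uniq (canon ([:: r] ++ [:: y; z] ++ D)) by rewrite uniq_canon_cons rD.
have N1 : ~~ (e y r && e z (s r)).
  apply/negP=> /andP[yr' zr'].
  by apply: (N ur (L := [:: y; r; z; s r])); [perm_count | rewrite /= yr' zr'].
have N2 : ~~ (e y (s r) && e z r).
  apply/negP=> /andP[yr' zr'].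
  by apply: (N ur (L := [:: y; s r; z; r])); [perm_count | rewrite /= yr' zr'].
move: (link_or yr ysr) (link_or zr zsr) N1 N2.
by case: (e y r) (e y (s r)) (e z r) (e z (s r)) => [] [] [] [].
Qed.

Definition left_side t :=
  (t \in [:: y; z]) || (t \notin canon ([:: y; z] ++ D)) && ~~ e y t.

(** Any two vertices of the left side can take over the role of [y] and [z]: the partner of a left
    vertex other than [y] and [z] is adjacent to both of these, so [y] and [z] can be matched to the
    partners that become free. *)
Lemma left_side_match t t' : left_side t -> left_side t' -> t != t' ->
  exists rs L, [/\ uniq (canon (rs ++ [:: y; z] ++ D)),
    perm_eq [:: t, t' & L] ([:: y; z] ++ canon rs) & paired e L].
Proof.
have match1 w : w \notin canon ([:: y; z] ++ D) -> ~~ e y w ->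
    [/\ uniq (canon ([:: w] ++ [:: y; z] ++ D)), e y (s w) & e z (s w)].
  move=> wD yw; have [zw yz] := two_left wD.
  have [|-> _] := @two_left (s w); first by rewrite mem_canon_s.
  by rewrite yz yw uniq_canon_cons wD.
rewrite /left_side !inE.
case/orP=> [/orP[]/eqP->|/andP[tD yt]]; case/orP=> [/orP[]/eqP->|/andP[tD' yt']] tt';
  rewrite ?eqxx // in tt'.
- by exists [::], [::].
- have [u1 y1 z1] := match1 _ tD' yt'.
  by exists [:: t'], [:: z; s t']; split; [| perm_count | rewrite /= z1].
- by exists [::], [::]; split; [| perm_count |].
- have [u1 y1 z1] := match1 _ tD' yt'.
  by exists [:: t'], [:: y; s t']; split; [| perm_count | rewrite /= y1].
- have [u1 y1 z1] := match1 _ tD yt.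
  by exists [:: t], [:: z; s t]; split; [| perm_count | rewrite /= z1].
- have [u1 y1 z1] := match1 _ tD yt.
  by exists [:: t], [:: y; s t]; split; [| perm_count | rewrite /= y1].
- have [u1 y1 z1] := match1 _ tD yt; have [u2 y2 z2] := match1 _ tD' yt'.
  exists [:: t; t'], [:: y; s t; z; s t'].
  split; [| perm_count | by rewrite /= y1 z2].
  rewrite uniq_canon_cons u2 andbT canon_cons !inE (negPf tt') (negPf tD) orbF.
  (* If [t] were the partner of [t'], then [y] would be adjacent to [t], which is a left vertex. *)
  by apply/eqP=> tst; case/negP: yt; rewrite tst.
Qed.

(** An edge between two left vertices would complete the matching of [left_side_match] to a
    forbidden one. *)
Lemma left_side_indep t t' : left_side t -> left_side t' -> ~~ e t t'.
Proof.
move=> It It'; apply/negP=> ett'.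
have [rs [L [urs LP pL]]] := left_side_match It It' (edge_neq e_irr ett').
by apply: (N urs LP); rewrite /= ett'.
Qed.

End TwoLeft.

(** * Four vertices left over: a half set without two disjoint edges *)

Definition no_two_edges (V : {set T}) := forall a b c d,
  {subset [:: a; b; c; d] <= V} -> e a b -> e c d -> uniq [:: a; b; c; d] -> False.

(** The vertices [k1], [k2], [k3] cover all edges inside [V], so two disjoint edges are covered by
    two different ones among them. Repetitions are allowed, so the lemma also serves for a cover by
    two vertices. *)
Lemma no_two_edges_cover (V : {set T}) k1 k2 k3 :
  (forall x y, x \in V -> y \in V -> x \notin [:: k1; k2; k3] ->
     y \notin [:: k1; k2; k3] -> ~~ e x y) ->
  (forall b d, b \in V -> d \in V -> e k1 b -> e k2 d -> uniq [:: k1; b; k2; d] -> False) ->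
  (forall b d, b \in V -> d \in V -> e k1 b -> e k3 d -> uniq [:: k1; b; k3; d] -> False) ->
  (forall b d, b \in V -> d \in V -> e k2 b -> e k3 d -> uniq [:: k2; b; k3; d] -> False) ->
  no_two_edges V.
Proof.
move=> ind H12 H13 H23 a b c d sub eab ecd u.
have K x y : x \in V -> y \in V -> e x y -> (x \in [:: k1; k2; k3]) || (y \in [:: k1; k2; k3]).
  by move=> xV yV; apply: contraTT; rewrite negb_or => /andP[? ?]; apply: ind.
have main x y z t : perm_eq [:: x; y; z; t] [:: a; b; c; d] -> e x y -> e z t ->
    x \in [:: k1; k2; k3] -> z \in [:: k1; k2; k3] -> False.
  move=> P exy ezt.
  have yV : y \in V by apply: sub; rewrite -(perm_mem P) !inE eqxx ?orbT.
  have tV : t \in V by apply: sub; rewrite -(perm_mem P) !inE eqxx ?orbT.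
  have u1 : uniq [:: x; y; z; t] by rewrite (perm_uniq P).
  have u2 : uniq [:: z; t; x; y].
    by rewrite -(perm_uniq (_ : perm_eq [:: x; y; z; t] _)) //; perm_count.
  rewrite !inE => /or3P[] /eqP xk /or3P[] /eqP zk; subst x z;
    by [apply: (H12 y t)|apply: (H13 y t)|apply: (H23 y t)|apply: (H12 t y)
       |apply: (H13 t y)|apply: (H23 t y)|move: u1; rewrite /= !inE eqxx !orbT].
have [aV bV cV dV] : [/\ a \in V, b \in V, c \in V & d \in V].
  by split; apply: sub; rewrite !inE eqxx ?orbT.
case/orP: (K a b aV bV eab) => ?; case/orP: (K c d cV dV ecd) => ?.
- by apply: (main a b c d).
- by apply: (main a b d c); rewrite // 1?e_sym //; perm_count.
- by apply: (main b a c d); rewrite // 1?e_sym //; perm_count.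
- by apply: (main b a d c); rewrite // 1?e_sym //; perm_count.
Qed.

Lemma uniq_canon_half_set V l : half_set V -> {subset l <= V} -> uniq l ->
  uniq (canon l).
Proof.
move=> tV; elim: l => // x l IH sub; rewrite cons_uniq => /andP[xl ul].
rewrite uniq_canon_cons IH // ?andbT => [|y yl]; last by apply: sub; rewrite inE yl orbT.
rewrite mem_canon negb_or xl; apply: contraTN (sub x (mem_head _ _)) => sxl.
by rewrite -tV; apply: sub; rewrite inE sxl orbT.
Qed.

(* The edge [{p, s p}] can serve to match [y1] and [y2], which are not
   adjacent, so that [y3; y4] is left for the remaining edges. *)
Section Rescued.
Variables (y1 y2 y3 y4 p : T).
Hypotheses (N : unmatchable [::] [:: y1; y2; y3; y4])
  (up : uniq (canon [:: p; y1; y2; y3; y4]))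
  (y1p : e y1 p) (y2sp : e y2 (s p)) (y12 : ~~ e y1 y2)
  (y1I : forall y, y \in [:: y3; y4] -> ~~ e y1 y)
  (y2I : forall y, y \in [:: y3; y4] -> ~~ e y2 y).

Let D := [:: p; y1; y2].

Let uD : uniq (canon ([:: y3; y4] ++ D)).
Proof. by rewrite -(perm_uniq (perm_canon (_ : perm_eq [:: p; y1; y2; y3; y4] _))) //; perm_count. Qed.

Lemma rescued_unmatchable rs L : uniq (canon (rs ++ [:: y3; y4] ++ D)) ->
  perm_eq L ([:: y1; y2; y3; y4] ++ canon (p :: rs)) -> paired e L -> False.
Proof.
move=> u; apply: N; rewrite cats0.
rewrite -(perm_uniq (perm_canon (_ : perm_eq (rs ++ [:: y3; y4] ++ D) _))) //.
by rewrite /D; perm_count.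
Qed.

Let N' : unmatchable D [:: y3; y4].
Proof.
move=> rs L u LP pL; apply: (rescued_unmatchable u (L := [:: y1; p; y2; s p] ++ L)).
  by perm_count_from LP.
by rewrite paired_cat /= ?y1p ?y2sp.
Qed.

Let I := left_side D y3 y4.

(** The edges from [y1] to [t], [p] to [t'] and [y2] to [s p] would leave only what
    [left_side_match] can match. *)
Lemma rescued_y1_p t t' : I t -> I t' -> t != t' -> e y1 t -> e p t' -> False.
Proof.
move=> It It' tt' y1t pt'; have [rs [L [urs LP pL]]] := left_side_match uD N' It It' tt'.
apply: (rescued_unmatchable urs (L := [:: y1; t; p; t'; y2; s p] ++ L)).
  by perm_count_from LP.
by rewrite /= y1t pt' y2sp.
Qed.

Lemma rescued_partner w : I w -> w \notin [:: y3; y4] ->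
  uniq (canon ([:: w] ++ [:: y3; y4] ++ D)) /\ e y4 (s w).
Proof.
case/orP=> [->//|/andP[wD yw] _].
have [|-> _] := two_left uD N' (r := s w); first by rewrite mem_canon_s.
by have [_ ->] := two_left uD N' wD; rewrite yw uniq_canon_cons wD.
Qed.

Hypotheses (y3sp : e y3 (s p)).

(** With [y1] matched to [w], [y2] to [p], [y3] to [s p] and [y4] to [s w], all four left-over
    vertices would be served. *)
Lemma rescued_y2_p w : I w -> e y1 w -> e y2 p -> False.
Proof.
move=> Iw y1w y2p; have [|uw y4w] := rescued_partner Iw.
  by apply: contraL y1w; apply: y1I.
apply: (rescued_unmatchable uw (L := [:: y1; w; y2; p; y3; s p; y4; s w])).
  perm_count.
by rewrite /= y1w y2p y3sp y4w.
Qed.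

Lemma rescued_y2_w w : I w -> e y2 w -> False.
Proof.
move=> Iw y2w; have [|uw y4w] := rescued_partner Iw.
  by apply: contraL y2w; apply: y2I.
apply: (rescued_unmatchable uw (L := [:: y1; p; y2; w; y3; s p; y4; s w])).
  perm_count.
by rewrite /= y1p y2w y3sp y4w.
Qed.

End Rescued.

(** The candidate half set: the prescribed representatives [D], and on each other edge the end that
    [y] does not see. *)
Definition sel (D : seq T) y :=
  [set x | (x \in D) || (x \notin canon D) && ~~ e y x].

Lemma sel_half_set D y : uniq (canon D) ->
  (forall x, x \notin canon D -> e y (s x) = ~~ e y x) -> half_set (sel D y).
Proof. by move=> uD eD; apply: half_set_sel => // x /eD ->. Qed.

Lemma sub_sel D y : {subset D <= sel D y}.
Proof. by move=> x xD; rewrite inE xD. Qed.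

Lemma sel_left_side D D' y z : perm_eq ([:: y; z] ++ D') D ->
  sel D y =i [predU [in D'] & left_side D' y z].
Proof.
move=> P x; rewrite !inE /left_side -(perm_mem P) -(perm_mem (perm_canon P)).
rewrite mem_cat; rewrite [RHS]orbA; congr (_ || _).
by rewrite orbC.
Qed.

(** All edges inside the half set meet [y1], [y2] or [p], because the left side is independent. The
    alternative on [w] makes [y2] nonadjacent to the left side, so [p] is its only possible
    neighbour in the half set; the lemmas on rescued configurations then exclude every pair of
    disjoint edges. *)
Lemma rescued_star_aux y1 y2 y3 y4 p : unmatchable [::] [:: y1; y2; y3; y4] ->
  uniq (canon [:: p; y1; y2; y3; y4]) ->
  e y1 p -> e y2 (s p) -> ~~ e y1 y2 ->
  (forall y, y \in [:: y3; y4] -> ~~ e y1 y) ->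
  (forall y, y \in [:: y3; y4] -> ~~ e y2 y) ->
  (exists2 w, left_side [:: p; y1; y2] y3 y4 w & e y1 w) \/
  (forall w, left_side [:: p; y1; y2] y3 y4 w -> ~~ e y1 w /\ ~~ e y2 w) ->
  half_set (sel [:: p; y1; y2; y3; y4] y3) /\
  no_two_edges (sel [:: p; y1; y2; y3; y4] y3).
Proof.
move=> N up y1p y2sp y12 y1I y2I cases.
have Pd : perm_eq ([:: y3; y4] ++ [:: p; y1; y2]) [:: p; y1; y2; y3; y4] by perm_count.
have uD : uniq (canon ([:: y3; y4] ++ [:: p; y1; y2])).
  by rewrite (perm_uniq (perm_canon Pd)).
have N' : unmatchable [:: p; y1; y2] [:: y3; y4].
  move=> rs L u LP pL.
  apply: (rescued_unmatchable N u (L := [:: y1; p; y2; s p] ++ L)).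
    by perm_count_from LP.
  by rewrite paired_cat /= ?y1p ?y2sp.
have VE x : x \in sel [:: p; y1; y2; y3; y4] y3 ->
    (x \in [:: p; y1; y2]) || left_side [:: p; y1; y2] y3 y4 x.
  by rewrite (sel_left_side Pd).
have VE4 x : x \in sel [:: p; y1; y2; y3; y4] y3 ->
    [\/ x = p, x = y1, x = y2 | left_side [:: p; y1; y2] y3 y4 x].
  move/VE; rewrite !inE -!orbA => /or4P[/eqP|/eqP|/eqP|] xE;
    by [apply: Or41|apply: Or42|apply: Or43|apply: Or44].
(* If [y3] were adjacent to [p], the edges [y1 w] and [p y3] would contradict [rescued_y1_p]; [link]
   leaves only [s p]. *)
have y3sp w : left_side [:: p; y1; y2] y3 y4 w -> e y1 w -> e y3 (s p).
  move=> Iw y1w.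
  have wy3 : w != y3 by apply: contraTneq y1w => ->; apply: y1I; rewrite mem_head.
  have I3 : left_side [:: p; y1; y2] y3 y4 y3 by rewrite /left_side mem_head.
  have py3 : ~~ e y3 p.
    by rewrite e_sym; apply/negP; apply: (rescued_y1_p N up y1p y2sp Iw I3 wy3 y1w).
  have pD : p \notin canon [:: y1; y2; y3; y4] by move: up; rewrite uniq_canon_cons => /andP[].
  have [y3p y3sp] : y3 != p /\ y3 != s p.
    move: pD; rewrite !mem_canon !inE !negb_or !s_eqC.
    by rewrite !(eq_sym y3) !s_eqC => /andP[/and4P[_ _ -> _] /and4P[_ _ -> _]].
  by move: (link_or y3p y3sp); rewrite (negPf py3).
have y2w w : left_side [:: p; y1; y2] y3 y4 w -> e y2 w = false.
  move=> Iw; case: cases => [[v Iv y1v]|none]; last by apply/negbTE; case: (none w Iw).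
  by apply/negP; apply: (rescued_y2_w N up y1p y2sp y2I (y3sp v Iv y1v)).
have y1w_y2p w : left_side [:: p; y1; y2] y3 y4 w -> e y1 w -> e y2 p = false.
  move=> Iw y1w; apply/negP.
  by apply: (rescued_y2_p N up y1p y2sp y1I (y3sp w Iw y1w) Iw y1w).
split.
  apply: sel_half_set => // x; rewrite -(perm_mem (perm_canon Pd)) => xD.
  by case: (two_left uD N' xD).
apply: (@no_two_edges_cover _ y1 y2 p).
- have inI x : x \in sel [:: p; y1; y2; y3; y4] y3 -> x \notin [:: y1; y2; p] ->
      left_side [:: p; y1; y2] y3 y4 x.
    move=> xV; rewrite (perm_mem (_ : perm_eq _ [:: p; y1; y2])); last by perm_count.
    by move/negPf=> xk; move: (VE x xV); rewrite xk.
  by move=> x y xV yV xk yk; apply: (left_side_indep uD N'); apply: inI.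
- move=> b d bV dV y1b y2d u.
  case: (VE4 _ dV) => dE; try subst d.
  + case: (VE4 _ bV) => bE; try subst b.
    * by move: u; rewrite /= !inE eqxx ?orbT ?andbF.
    * by rewrite e_irr in y1b.
    * by rewrite (negPf y12) in y1b.
    * by have := y1w_y2p b bE y1b; rewrite y2d.
  + by rewrite e_sym (negPf y12) in y2d.
  + by rewrite e_irr in y2d.
  + by have := y2w d dE; rewrite y2d.
- move=> b d bV dV y1b pd u.
  case: (VE4 _ bV) => bE; try subst b.
  + by move: u; rewrite /= !inE eqxx ?orbT ?andbF.
  + by rewrite e_irr in y1b.
  + by rewrite (negPf y12) in y1b.
  + case: (VE4 _ dV) => dE; try subst d.
    * by rewrite e_irr in pd.
    * by move: u; rewrite /= !inE eqxx ?orbT ?andbF.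
    * by have := y1w_y2p b bE y1b; rewrite e_sym pd.
    * apply: (rescued_y1_p N up y1p y2sp bE dE _ y1b pd).
      by move: u; rewrite /= !inE !negb_or => /and4P[_ /andP[_ ->]].
- move=> b d bV dV y2b pd u.
  case: (VE4 _ bV) => bE; try subst b.
  + by move: u; rewrite /= !inE eqxx ?orbT ?andbF.
  + by rewrite e_sym (negPf y12) in y2b.
  + by rewrite e_irr in y2b.
  + by have := y2w b bE; rewrite y2b.
Qed.

Lemma four_left_rescued y1 y2 y3 y4 p : unmatchable [::] [:: y1; y2; y3; y4] ->
  uniq (canon [:: p; y1; y2; y3; y4]) ->
  e y1 p -> e y2 (s p) -> ~~ e y1 y2 ->
  (forall y, y \in [:: y3; y4] -> ~~ e y1 y) ->
  (forall y, y \in [:: y3; y4] -> ~~ e y2 y) ->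
  exists V, [/\ half_set V, {subset [:: y1; y2; y3; y4] <= V} & no_two_edges V].
Proof.
move=> N up y1p y2sp y12 y1I y2I.
pose D := [:: p; y1; y2].
have subV q l : {subset l <= sel (q :: l) y3}.
  by move=> x xl; apply: sub_sel; rewrite inE xl orbT.
have [/existsP[w /andP[Iw y1w]]|no1] := boolP [exists w, left_side D y3 y4 w && e y1 w].
  have [] := rescued_star_aux N up y1p y2sp y12 y1I y2I; first by left; exists w.
  by move=> tV nV; exists (sel [:: p; y1; y2; y3; y4] y3).
(* If only [y2] has a neighbour on the left side, the configuration is used with [y1], [y2]
   exchanged and [p], [s p] exchanged. *)
have [/existsP[w /andP[Iw y2w]]|no2] := boolP [exists w, left_side D y3 y4 w && e y2 w].
  have P : perm_eq [:: y1; y2; y3; y4] [:: y2; y1; y3; y4] by perm_count.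
  have up' : uniq (canon [:: s p; y2; y1; y3; y4]).
    have Pc : perm_eq (canon [:: s p; y2; y1; y3; y4]) (canon [:: p; y1; y2; y3; y4]).
      perm_count.
    by rewrite (perm_uniq Pc).
  have [] := rescued_star_aux (unmatchable_perm P N) up' y2sp _ _ y2I y1I.
  - by rewrite sK.
  - by rewrite e_sym.
  - left; exists w => //; move: Iw; rewrite /left_side.
    have Pc : perm_eq (canon ([:: y3; y4] ++ [:: s p; y2; y1])) (canon ([:: y3; y4] ++ D)).
      by rewrite /D; perm_count.
    by rewrite (perm_mem Pc).
  move=> tV nV; exists (sel [:: s p; y2; y1; y3; y4] y3); split=> //.
  by move=> x; rewrite (perm_mem P); apply: subV.
have [] := rescued_star_aux N up y1p y2sp y12 y1I y2I.
  right=> w Iw; move/existsPn/(_ w): no1; move/existsPn/(_ w): no2.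
  by rewrite Iw.
by move=> tV nV; exists (sel [:: p; y1; y2; y3; y4] y3).
Qed.

(** Matching [y1] with [y2] leaves [y3] and [y4], so the case of two vertices applies and [y1], [y2]
    cover all edges in the half set. Disjoint edges from [y1] and [y2] to left vertices [b], [d]
    could be completed by [left_side_match]. *)
Lemma four_left_edge y1 y2 y3 y4 : unmatchable [::] [:: y1; y2; y3; y4] ->
  uniq (canon [:: y1; y2; y3; y4]) -> e y1 y2 ->
  exists V, [/\ half_set V, {subset [:: y1; y2; y3; y4] <= V} & no_two_edges V].
Proof.
move=> N u y12; pose D := [:: y1; y2].
have Pd : perm_eq ([:: y3; y4] ++ D) [:: y1; y2; y3; y4] by perm_count.
have uD : uniq (canon ([:: y3; y4] ++ D)) by rewrite (perm_uniq (perm_canon Pd)).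
have NN rs L : uniq (canon (rs ++ [:: y3; y4] ++ D)) ->
    perm_eq L ([:: y1; y2; y3; y4] ++ canon rs) -> paired e L -> False.
  move=> urs; apply: N; rewrite cats0.
  rewrite -(perm_uniq (perm_canon (_ : perm_eq (rs ++ [:: y3; y4] ++ D) _))) //.
  by rewrite perm_cat2l.
have N' : unmatchable D [:: y3; y4].
  move=> rs L urs LP pL; apply: (NN rs ([:: y1; y2] ++ L) urs); last by rewrite /= y12.
  by rewrite -[X in perm_eq _ X]/([:: y1; y2] ++ ([:: y3; y4] ++ canon rs)) perm_cat2l.
have VE x : x \in sel [:: y1; y2; y3; y4] y3 -> (x \in D) || left_side D y3 y4 x.
  by rewrite (sel_left_side Pd).
have inI x : x \in sel [:: y1; y2; y3; y4] y3 -> x != y1 -> x != y2 ->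
    left_side D y3 y4 x.
  by move=> /VE; rewrite !inE => + /negPf xy1 /negPf xy2; rewrite xy1 xy2.
have main b d : b \in sel [:: y1; y2; y3; y4] y3 -> d \in sel [:: y1; y2; y3; y4] y3 ->
    e y1 b -> e y2 d -> uniq [:: y1; b; y2; d] -> False.
  move=> bV dV y1b y2d /=; rewrite !inE !negb_or.
  case/and4P=> /and3P[y1b' _ y1d'] /andP[by2 bd] y2d' _.
  have [rs [L [urs LP pL]]] : exists rs L, [/\ uniq (canon (rs ++ [:: y3; y4] ++ D)),
      perm_eq [:: b, d & L] ([:: y3; y4] ++ canon rs) & paired e L].
    by apply: (left_side_match uD N') => //; apply: inI => //; rewrite eq_sym.
  apply: (NN rs ([:: y1; b; y2; d] ++ L) urs); last by rewrite /= y1b y2d.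
  by perm_count_from LP.
exists (sel [:: y1; y2; y3; y4] y3); split.
- apply: sel_half_set => // x; rewrite -(perm_mem (perm_canon Pd)) => xD.
  by case: (two_left uD N' xD).
- exact: sub_sel.
- apply: (@no_two_edges_cover _ y1 y2 y2) => //.
  + move=> x y xV yV; rewrite !inE !orbb !negb_or => /andP[? ?] /andP[? ?].
    by apply: (left_side_indep uD N'); apply: inI.
  + by move=> b d _ _ _ _ /=; rewrite !inE eqxx /= orbT.
Qed.

(** Three cases: two of the four vertices are adjacent; two of them see opposite ends of some
    further edge; or neither, and then all four see one and the same end of every further edge. *)
Lemma four_left ys : size ys = 4 -> unmatchable [::] ys -> uniq (canon ys) ->
  exists V, [/\ half_set V, {subset ys <= V} & no_two_edges V].
Proof.
move=> sz N u.
have via z1 z2 z3 z4 : perm_eq ys [:: z1; z2; z3; z4] ->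
    (unmatchable [::] [:: z1; z2; z3; z4] -> uniq (canon [:: z1; z2; z3; z4]) ->
      exists V, [/\ half_set V, {subset [:: z1; z2; z3; z4] <= V} & no_two_edges V]) ->
    exists V, [/\ half_set V, {subset ys <= V} & no_two_edges V].
  move=> P H; have [] := H (unmatchable_perm P N).
    by rewrite -(perm_uniq (perm_canon P)).
  by move=> V [tV sV nV]; exists V; split=> // x; rewrite (perm_mem P); apply: sV.
pose edge4 := [exists a, exists b, exists c, exists d, perm_eq ys [:: a; b; c; d] && e a b].
have [|noedge] := boolP edge4.
  case/existsP=> a /existsP[b /existsP[c /existsP[d /andP[P eab]]]].
  by apply: (via a b c d P) => Np up; apply: four_left_edge.
have noe a b c d : perm_eq ys [:: a; b; c; d] -> ~~ e a b.
  move=> P; apply: contra noedge => eab.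
  by apply/existsP; exists a; apply/existsP; exists b; apply/existsP; exists c;
     apply/existsP; exists d; rewrite P.
pose resc4 := [exists p, exists a, exists b, exists c, exists d,
  [&& p \notin canon ys, perm_eq ys [:: a; b; c; d], e a p & e b (s p)]].
have [|noresc] := boolP resc4.
  case/existsP=> p /existsP[a /existsP[b /existsP[c /existsP[d /and4P[pD P eap ebp]]]]].
  apply: (via a b c d P) => Np up; apply: (four_left_rescued Np _ eap ebp).
  - by rewrite uniq_canon_cons up -(perm_mem (perm_canon P)) pD.
  - exact: noe P.
  - by move=> y; rewrite !inE => /orP[]/eqP->;
      [apply: (noe _ _ b d)|apply: (noe _ _ b c)]; apply: (perm_trans P); perm_count.
  - by move=> y; rewrite !inE => /orP[]/eqP->;
      [apply: (noe _ _ a d)|apply: (noe _ _ a c)]; apply: (perm_trans P); perm_count.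
have nor p a b c d : p \notin canon ys -> perm_eq ys [:: a; b; c; d] ->
    ~~ (e a p && e b (s p)).
  move=> pD P; apply: contra noresc => eab.
  by apply/existsP; exists p; apply/existsP; exists a; apply/existsP; exists b;
     apply/existsP; exists c; apply/existsP; exists d; rewrite pD P.
case: ys sz N u {via edge4 resc4 noedge noresc} noe nor
  => [//|y1 [//|y2 [//|y3 [//|y4 [|//]]]]] _ N u noe nor.
have link_y y p : y \in [:: y1; y2; y3; y4] -> p \notin canon [:: y1; y2; y3; y4] ->
    e y p || e y (s p).
  move=> yY pD; apply: link_or.
    by apply: contraNneq pD => <-; rewrite mem_canon yY.
  by apply: contraNneq pD => ypE; rewrite mem_canon -ypE yY orbT.
have perm2 y y' : y \in [:: y1; y2; y3; y4] -> y' \in [:: y1; y2; y3; y4] -> y != y' ->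
    exists c d, perm_eq [:: y1; y2; y3; y4] [:: y; y'; c; d].
  move=> yY yY' nyy'; have P1 := perm_to_rem yY.
  have yY2 : y' \in rem y [:: y1; y2; y3; y4].
    by rewrite mem_rem_uniq ?(uniq_canon_uniq u) // inE eq_sym nyy'.
  have P2 := perm_to_rem yY2.
  have sz2 : size (rem y' (rem y [:: y1; y2; y3; y4])) = 2 by rewrite !size_rem.
  case E : (rem y' (rem y [:: y1; y2; y3; y4])) sz2 => [|c [|d [|]]] // _.
  by exists c, d; rewrite (perm_trans P1) // perm_cons -E.
have unresc y y' p : p \notin canon [:: y1; y2; y3; y4] ->
    y \in [:: y1; y2; y3; y4] -> y' \in [:: y1; y2; y3; y4] -> y != y' ->
    ~~ (e y p && e y' (s p)).
  by move=> pD yY yY' nyy'; have [c [d P]] := perm2 y y' yY yY' nyy'; exact: nor P.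
have uniqnb p y : p \notin canon [:: y1; y2; y3; y4] -> ~~ e y1 p ->
    y \in [:: y1; y2; y3; y4] -> e y (s p) /\ ~~ e y p.
  move=> pD y1p yY.
  have y1sp : e y1 (s p) by move: (link_y y1 p (mem_head _ _) pD); rewrite (negPf y1p).
  have [->|ny1] := eqVneq y y1; first by [].
  have := unresc y y1 p pD yY (mem_head _ _) ny1; rewrite y1sp andbT => yp.
  by move: (link_y y p yY pD); rewrite (negPf yp).
have tV : half_set (sel [:: y1; y2; y3; y4] y1).
  apply: sel_half_set => // p pD.
  (* If [y1] saw both ends of the edge at [p], then [y2] could see neither of them, against
     [link]. *)
  have [y1p|y1p] /= := boolP (e y1 p); last by case: (uniqnb p y1 pD y1p (mem_head _ _)).
  apply/negP=> y1sp.
  have ny21 : y2 != y1.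
    by move: (uniq_canon_uniq u); rewrite /= !inE !negb_or eq_sym => /andP[/andP[]].
  have y2Y : y2 \in [:: y1; y2; y3; y4] by rewrite !inE eqxx orbT.
  have y1Y := mem_head y1 [:: y2; y3; y4].
  have := unresc y2 y1 p pD y2Y y1Y ny21; rewrite y1sp andbT => y2p.
  have := unresc y1 y2 p pD y1Y y2Y; rewrite eq_sym y1p => /(_ ny21) /= y2sp.
  by move: (link_y y2 p y2Y pD); rewrite (negPf y2p) (negPf y2sp).
exists (sel [:: y1; y2; y3; y4] y1); split=> //; first exact: sub_sel.
(* The four vertices have no neighbours in the half set, so its edges lie on the unseen ends. *)
have isol x t : x \in sel [:: y1; y2; y3; y4] y1 -> t \in sel [:: y1; y2; y3; y4] y1 ->
    e x t -> x \notin canon [:: y1; y2; y3; y4] /\ ~~ e y1 x.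
  rewrite ![_ \in sel _ _]inE => /orP[xY|/andP[-> ->] //] /orP[tY|/andP[tD y1t]] ext.
    have [c [d /noe]] := perm2 x t xY tY (edge_neq e_irr ext).
    by rewrite ext.
  by case: (uniqnb t x tD y1t xY) => _; rewrite ext.
move=> a b c d sub eab ecd uabcd.
have [aV bV cV dV] : [/\ a \in sel [:: y1; y2; y3; y4] y1, b \in sel [:: y1; y2; y3; y4] y1,
    c \in sel [:: y1; y2; y3; y4] y1 & d \in sel [:: y1; y2; y3; y4] y1].
  by split; apply: sub; rewrite !inE eqxx ?orbT.
have [aD y1a] := isol a b aV bV eab; have [cD y1c] := isol c d cV dV ecd.
have [bD y1b] : b \notin canon [:: y1; y2; y3; y4] /\ ~~ e y1 b.
  by apply: (isol b a) => //; rewrite e_sym.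
have [dD y1d] : d \notin canon [:: y1; y2; y3; y4] /\ ~~ e y1 d.
  by apply: (isol d c) => //; rewrite e_sym.
have nY x : x \notin canon [:: y1; y2; y3; y4] -> x \notin [:: y1; y2; y3; y4].
  by rewrite mem_canon negb_or => /andP[].
have uL : uniq (canon ([:: a; b; c; d] ++ [:: y1; y2; y3; y4] ++ [::])).
  apply: (uniq_canon_half_set tV).
    by move=> x; rewrite cats0 mem_cat => /orP[/sub|/sub_sel].
  rewrite cats0 cat_uniq uabcd (uniq_canon_uniq u) andbT andTb.
  have /allP free : all [pred x | x \notin canon [:: y1; y2; y3; y4]] [:: a; b; c; d].
    by apply/and5P; split.
  by apply/hasPn=> x; apply: contraL => /free; apply: nY.
(* Two disjoint edges [a b] and [c d] set free the four partners, which [y1] to [y4] all see. *)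
apply: (N _ [:: a; b; c; d; y1; s a; y2; s b; y3; s c; y4; s d] uL).
  perm_count.
have [e1 _] := uniqnb a y1 aD y1a (mem_head _ _).
have [|e2 _] := uniqnb b y2 bD y1b; first by rewrite !inE eqxx orbT.
have [|e3 _] := uniqnb c y3 cD y1c; first by rewrite !inE eqxx !orbT.
have [|e4 _] := uniqnb d y4 dD y1d; first by rewrite !inE eqxx !orbT.
by rewrite /= eab ecd e1 e2 e3 e4.
Qed.

(** * Independent half sets, and the triangle and star structures *)

Lemma half_set_imset V : half_set V -> s @: V = ~: V.
Proof.
move=> tV; apply/setP=> x; rewrite inE; apply/imsetP/idP => [[y yV ->]|xV].
  by rewrite tV negbK.
by exists (s x); rewrite ?sK // tV.
Qed.

Lemma card_half_set V : half_set V -> #|~: V| = #|V|.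
Proof. by move=> tV; rewrite -half_set_imset // card_imset //; apply: inv_inj. Qed.

Definition extends_edge a b := exists2 M, perfect_matching e M & [set a; b] \in M.

(** A perfect matching maps an independent [V] into its complement, hence onto it by cardinality,
    and so has no edge inside the complement. *)
Lemma indep_half_set_edge V a b : half_set V -> independent V ->
  extends_edge a b -> a \notin V -> b \notin V -> False.
Proof.
move=> tV iV [M /(perfect_matching_partner e_sym e_irr)[t [tK et Mt _]] Mab] aV bV.
have sub : t @: V \subset ~: V.
  by apply/subsetP=> _ /imsetP[x xV ->]; rewrite inE; apply: contraL (et x) => /(iV _ _ xV).
have : t @: V == ~: V.
  by rewrite eqEcard sub card_half_set // (card_imset _ (inv_inj tK)) leqnn.
move=> /eqP/setP/(_ a); rewrite inE aV => /imsetP[x xV ax].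
by move: Mab; rewrite Mt ax tK => /eqP bx; rewrite bx xV in bV.
Qed.

(** Of two disjoint edges in [W] one avoids [k], hence lies in the complement of [V] and cannot
    extend. *)
Lemma indep_half_set_two_indep V W k : half_set V -> independent V ->
  (forall a b, e a b -> extends_edge a b) ->
  two_indep_edges e W -> (forall x, x \in W -> x != k -> x \notin V) -> False.
Proof.
move=> tV iV ext /(two_indepP e_irr)[a [b [c [d [sub eab ecd]]]]] /=.
rewrite !inE !negb_or => /and4P[/and3P[_ ac ad] /andP[bc bd] _ _] WV.
have [aW bW cW dW] : [/\ a \in W, b \in W, c \in W & d \in W].
  by split; apply: sub; rewrite !inE eqxx ?orbT.
have [ka|ka] := eqVneq a k; last have [kb|kb] := eqVneq b k.
- apply: (indep_half_set_edge tV iV (ext _ _ ecd)); apply: WV => //;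
    by rewrite -ka eq_sym.
- apply: (indep_half_set_edge tV iV (ext _ _ ecd)); apply: WV => //;
    by rewrite -kb eq_sym.
- by apply: (indep_half_set_edge tV iV (ext _ _ eab)); apply: WV.
Qed.

(** The structure of (i) for V the set of the v_i, apart from the bound on n. *)
Definition triangle_type (V : {set T}) :=
  (exists a b c : T,
     [/\ [&& a \in V, b \in V & c \in V],
         [&& e a b, e b c & e a c] &
         forall x y : T, x \in V -> y \in V -> e x y ->
           (x \in [set a; b; c]) && (y \in [set a; b; c])]) /\
  two_indep_edges e (~: V).

(** The structure of (ii), with [z] as v_n and [s z] as u_n. *)
Definition star_type (V : {set T}) z :=
  [/\ z \in V, independent (V :\ z), two_indep_edges e (z |: ~: V),
      exists2 i, i \in V :\ z & e i z &
      exists2 j, j \in V :\ z & e j (s z)].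

(** The last two clauses of [star_type] come for free from 1-extendability: if [z] has no neighbour
    in [V :\ z] then [V] is an independent half set, and if [s z] has none there, exchanging [z] for
    [s z] gives one. *)
Lemma star_type_intro V z : (forall a b, e a b -> extends_edge a b) ->
  half_set V -> z \in V -> independent (V :\ z) ->
  two_indep_edges e (z |: ~: V) -> star_type V z.
Proof.
move=> ext tV zV iV two; split=> //; apply/exists_inP; apply: contraT => none; exfalso.
- have nz i : i \in V :\ z -> ~~ e i z.
    by move=> iz; apply: contra none => eiz; apply/existsP; exists i; rewrite iz.
  apply: (indep_half_set_two_indep (k := z) tV _ ext two); last first.
    by move=> x; rewrite !inE => /orP[->|].
  move=> x y xV yV; have [->|xz] := eqVneq x z.
    have [->|yz] := eqVneq y z; first by rewrite e_irr.
    by rewrite e_sym nz // !inE yz.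
  have [->|yz] := eqVneq y z; first by rewrite nz // !inE xz.
  by apply: iV; rewrite !inE ?xz ?yz.
- have nz i : i \in V :\ z -> ~~ e i (s z).
    by move=> iz; apply: contra none => eiz; apply/existsP; exists i; rewrite iz.
  have tV' : half_set (s z |: V :\ z).
    move=> x; rewrite !inE s_eq s_eqC tV negb_or negb_and negbK.
    have [->|xz] /= := eqVneq x z; first by rewrite eq_sym s_neq.
    by have [->|] := eqVneq x (s z); rewrite //= tV zV.
  apply: (indep_half_set_two_indep (k := s z) tV' _ ext two); last first.
    move=> x; rewrite !inE negb_or negb_and negbK => + ->.
    by case/orP=> ->; rewrite ?orbT.
  have iz x y : x \in s z |: V :\ z -> y \in V :\ z -> ~~ e x y.
    by case/setU1P=> [-> /nz|xV yV]; [rewrite e_sym | apply: iV].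
  move=> x y xV /setU1P[->|yV]; last exact: iz.
  case/setU1P: xV => [->|/nz //]; by rewrite e_irr.
Qed.

(** Pairwise intersecting edges either share a vertex or form a triangle. *)
Lemma no_two_edges_cases V : (forall a b, e a b -> extends_edge a b) ->
  half_set V -> no_two_edges V -> two_indep_edges e (~: V) ->
  triangle_type V \/ exists z, star_type V z.
Proof.
move=> ext tV nV two.
have star z : z \in V -> independent (V :\ z) -> exists z, star_type V z.
  move=> zV iV; exists z; apply: star_type_intro => //.
  have /(two_indepP e_irr)[a [b [c [d [sub eab ecd u]]]]] := two.
  apply/(two_indepP e_irr); exists a, b, c, d; split=> // x /sub.
  by rewrite !inE orbC => ->.
have edge_or (W : {set T}) : independent W \/ exists a b, [/\ a \in W, b \in W & e a b].
  have [/existsP[a /existsP[b /and3P[aW bW eab]]]|no] :=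
    boolP [exists a, exists b, [&& a \in W, b \in W & e a b]].
    by right; exists a, b.
  left=> a b aW bW; apply: contra no => eab.
  by apply/existsP; exists a; apply/existsP; exists b; rewrite aW bW.
have meet a b c d : a \in V -> b \in V -> c \in V -> d \in V -> e a b -> e c d ->
    [\/ a = c, a = d, b = c | b = d].
  move=> aV bV cV dV eab ecd.
  have [->|ac] := eqVneq a c; first by apply: Or41.
  have [->|ad] := eqVneq a d; first by apply: Or42.
  have [->|bc] := eqVneq b c; first by apply: Or43.
  have [->|bd] := eqVneq b d; first by apply: Or44.
  case: (nV a b c d) => //.
    by move=> x; rewrite !inE => /or4P[] /eqP->.
  by rewrite /= !inE !negb_or ac ad bc bd !(edge_neq e_irr).
case: (edge_or V) => [iV|[a [b [aV bV eab]]]].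
  have /(two_indepP e_irr)[a [b [c [d [sub _ _ _]]]]] := two.
  (* Without edges in [V] any of its vertices can be the centre; the partner of a vertex of the
     complement is one. *)
  right; apply: (star (s a)).
    by have := sub a (mem_head _ _); rewrite inE tV.
  by move=> x y /setD1P[_ xV] /setD1P[_ yV]; apply: iV.
have [ia|[x [y []]]] := edge_or (V :\ a); first by right; apply: (star a).
rewrite !inE => /andP[xa xV] /andP[ya yV] exy.
have [c [cV ca ebc]] : exists c, [/\ c \in V, c != a & e b c].
  case: (meet _ _ _ _ aV bV xV yV eab exy) => E; subst.
  - by rewrite eqxx in xa.
  - by rewrite eqxx in ya.
  - by exists y.
  - by exists x; rewrite e_sym.
have [ib|[x' [y' []]]] := edge_or (V :\ b); first by right; apply: (star b).
rewrite !inE => /andP[xb x'V] /andP[yb y'V] exy'.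
have eac : e a c.
  have := meet _ _ _ _ aV bV x'V y'V eab exy'.
  have := meet _ _ _ _ bV cV x'V y'V ebc exy'.
  case=> E1; case=> E2; subst; rewrite ?eqxx // in xb yb ca *.
  by rewrite e_sym.
left; split=> //; exists a, b, c; split; first by rewrite aV bV cV.
  by rewrite eab ebc eac.
have inabc t t' : t \in V -> t' \in V -> e t t' -> t \in [set a; b; c].
  move=> tV' t'V ett'; rewrite !inE.
  have := meet _ _ _ _ aV bV tV' t'V eab ett'.
  have := meet _ _ _ _ bV cV tV' t'V ebc ett'.
  have := meet _ _ _ _ aV cV tV' t'V eac ett'.
  have [ab bc] := (edge_neq e_irr eab, edge_neq e_irr ebc).
  by case=> E1; case=> E2; case=> E3; subst; rewrite ?eqxx ?orbT // in ab bc ca *.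
by move=> t t' tV' t'V ett'; rewrite (inabc t t') // (inabc t' t) // e_sym.
Qed.

(** * From a non-extendable pair of edges to the structure *)

Section Forward.
Variables (a b c d : T).
Hypothesis ext : forall x y, e x y -> extends_edge x y.
Hypotheses (eab : e a b) (ecd : e c d) (uX : uniq [:: a; b; c; d]).
Hypothesis nonext : forall L, paired e ([:: a; b; c; d] ++ L) ->
  uniq ([:: a; b; c; d] ++ L) -> (forall x, x \in [:: a; b; c; d] ++ L) -> False.

Let good V := half_set V /\ (triangle_type V \/ exists z, star_type V z).

Let pX : paired e [:: a; b; c; d].
Proof. by rewrite /= eab ecd. Qed.

Let zero_left k l : perm_eq [:: a; b; c; d] (canon [:: k; l]) -> False.
Proof.
move=> P; have u : uniq (canon ([::] ++ [:: k; l])) by rewrite -(perm_uniq P).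
have N : unmatchable [:: k; l] [::] by apply: (nonext_unmatchable u) pX _; rewrite ?cats0.
exact: (N [::] [::] u).
Qed.

(** Here [k] and [s k] are the only partners among the four ends. The left side of [y], [z] with [k]
    added is the half set, [k] is the centre of the star, and the non-extendable edges themselves
    are the two independent ones. *)
Let two_left_good k y z : perm_eq [:: a; b; c; d] [:: k; s k; s y; s z] -> y != s z ->
  exists V, good V.
Proof.
move=> P ysz.
have u : uniq (canon ([:: y; z] ++ [:: k])).
  have : [&& s y != k, s z != k, y != k, z != k & y != z].
    have := uX; rewrite (perm_uniq P) /= !inE !s_eq !negb_or ![k == _]eq_sym.
    by case/and4P=> /and3P[_ -> ->] /andP[-> ->] ->.
  case/and5P=> syk szk yk zk yz; rewrite -[_ ++ _]/[:: y; z; k].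
  by rewrite !uniq_canon_cons !mem_canon !inE !negb_or yz yk syk s_eqC ysz szk zk.
have N : unmatchable [:: k] [:: y; z].
  apply: (nonext_unmatchable u) pX nonext.
  by rewrite (perm_trans (_ : perm_eq _ ([:: k; s k; s y; s z] ++ [:: y; z]))) ?perm_cat2r //; perm_count.
have Pd : perm_eq ([:: y; z] ++ [:: k]) [:: y; z; k] by [].
have tV : half_set (sel [:: y; z; k] y).
  by apply: sel_half_set => // x xD; case: (two_left u N xD).
exists (sel [:: y; z; k] y); split=> //; right; exists k.
have inV x : x \in [:: y; z; k] -> x \in sel [:: y; z; k] y by apply: sub_sel.
apply: star_type_intro => //.
- by apply: inV; rewrite !inE eqxx !orbT.
- have inI x : x \in sel [:: y; z; k] y :\ k -> left_side [:: k] y z x.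
    by rewrite in_setD1 (sel_left_side Pd) !inE => /andP[/negPf-> /=]; rewrite ?inE.
  by move=> x x' /inI xI /inI xI'; apply: (left_side_indep u N).
- apply/(two_indepP e_irr); exists a, b, c, d; split=> // x.
  rewrite (perm_mem P) in_setU1 in_setC !in_cons in_nil orbF.
  case/or4P=> /eqP->; rewrite ?eqxx // tV negbK inV ?orbT // !inE eqxx ?orbT //.
Qed.

(** Case distinction on which of [a], [b], [c], [d] are partners of each other: two such pairs, one,
    or none. *)
Lemma nonext_pair_good : exists V, good V.
Proof.
have := uX; rewrite /= !inE !negb_or => /and4P[/and3P[ab ac ad] /andP[bc bd] cd _].
have [bE|bsa] := eqVneq b (s a).
  have [dE|dsc] := eqVneq d (s c).
    by case: (@zero_left a c); rewrite /= bE dE.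
  apply: (@two_left_good a (s c) (s d)); first by rewrite bE !sK.
  by rewrite s_eq eq_sym s_eqC.
have [dE|dsc] := eqVneq d (s c).
  apply: (@two_left_good c (s a) (s b)); first by rewrite dE !sK; perm_count.
  by rewrite s_eq eq_sym s_eqC.
have [cE|csa] := eqVneq c (s a).
  have [dE|dsb] := eqVneq d (s b).
    by case: (@zero_left a b); rewrite cE dE; perm_count.
  apply: (@two_left_good a (s b) (s d)); first by rewrite cE !sK; perm_count.
  by rewrite s_eq eq_sym s_eqC.
have [cE|csb] := eqVneq c (s b).
  have [dE|dsa] := eqVneq d (s a).
    by case: (@zero_left a b); rewrite cE dE; perm_count.
  apply: (@two_left_good b (s a) (s d)); first by rewrite cE !sK; perm_count.
  by rewrite s_eq eq_sym s_eqC.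
have [dE|dsa] := eqVneq d (s a).
  apply: (@two_left_good a (s b) (s c)); first by rewrite dE !sK; perm_count.
  by rewrite s_eq eq_sym s_eqC.
have [dE|dsb] := eqVneq d (s b).
  apply: (@two_left_good b (s a) (s c)); first by rewrite dE !sK; perm_count.
  by rewrite s_eq eq_sym s_eqC.
have u : uniq (canon [:: s a; s b; s c; s d]).
  have u' : uniq (canon [:: a; b; c; d]).
    rewrite !uniq_canon_cons !mem_canon !inE !negb_or !s_eqC ab ac ad bc bd cd /=.
    by rewrite ![_ == s b]eq_sym ![_ == s c]eq_sym ![_ == s d]eq_sym !s_eqC bsa csa dsa csb dsb dsc.
  have P : perm_eq (canon [:: a; b; c; d]) (canon [:: s a; s b; s c; s d]) by perm_count.
  by rewrite -(perm_uniq P).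
have N : unmatchable [::] [:: s a; s b; s c; s d].
  apply: (nonext_unmatchable _ _ pX nonext) => //.
  by perm_count.
have [V [tV sV nV]] := @four_left [:: s a; s b; s c; s d] (erefl 4) N u.
exists V; split=> //; apply: no_two_edges_cases => //.
apply/(two_indepP e_irr); exists a, b, c, d; split=> // x xX.
rewrite inE -[x]sK tV negbK; apply: sV; move: xX.
by rewrite !inE !s_eq.
Qed.

End Forward.

(** * Connectedness; the structures admit no independent half set *)

Lemma connected_dense : connected_graph e.
Proof.
apply/forallP=> x; apply/forallP=> y.
have [->|xy] := eqVneq x y; first exact: connect0.
have [->|xsy] := eqVneq x (s y); first by apply: connect1; rewrite e_sym.
case/orP: (link_or xy xsy) => exy; first exact: connect1.
by apply: (connect_trans (connect1 exy)); apply: connect1; rewrite e_sym.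
Qed.

Lemma link_cross x y : x != y -> x != s y -> ~~ e x y -> e x (s y) /\ e (s x) y.
Proof. by move=> xy xsy nxy; move: (link xy xsy); rewrite (negPf nxy) => /andP. Qed.

Lemma half_set_neq V x y : half_set V -> x \in V -> y \in V -> x != s y.
Proof. by move=> tV xV yV; apply: contraTneq xV => ->; rewrite tV negbK. Qed.

(** By [link], distinct [x], [y] in [V :\ z] satisfy [e x (s y)], so [I] contains either all of
    [V :\ z] or all of its partners. *)
Lemma star_type_no_indep V z I : half_set V -> star_type V z ->
  half_set I -> independent I -> False.
Proof.
move=> tV [zV iV two [i iz eiz] [j jz ejz]] tI iI.
have crossV x y : x \in V :\ z -> y \in V :\ z -> x != y -> e x (s y).
  move=> xV yV xy; case: (link_cross xy _ (iV _ _ xV yV)) => //.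
  by case/setD1P: xV => _ xV; case/setD1P: yV => _ yV; apply: (half_set_neq tV).
have [/existsP[x /andP[xV xI]]|none] := boolP [exists x, (x \in V :\ z) && (x \in I)].
  (* In the first case the neighbours [i] of [z] and [j] of [s z] keep both ends of that edge out of
     [I]. *)
  have sub y : y \in V :\ z -> y \in I.
    move=> yV; have [<-//|xy] := eqVneq x y.
    rewrite -[_ \in I]negbK -tI; apply: contraL (crossV x y xV yV xy).
    exact: iI.
  have [zI|] := boolP (z \in I).
    by move: (iI _ _ (sub i iz) zI); rewrite eiz.
  by rewrite -tI => szI; move: (iI _ _ (sub j jz) szI); rewrite ejz.
have sI x : x \in V :\ z -> s x \in I.
  by move=> xV; rewrite tI; move/existsPn/(_ x): none; rewrite xV.
have nI x y : x \in I -> y \in I -> e x y -> False.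
  by move=> xI yI; apply/negP; apply: iI.
(* In the second case [I] contains all of [z |: ~: V] except [k], the end of the edge at [z] missing
   from [I]; one of the two independent edges avoids [k]. *)
have key k : (z == k) || (z \in I) -> (s z == k) || (s z \in I) -> False.
  move=> zk szk; have inI x : x \in z |: ~: V -> x != k -> x \in I.
    rewrite !inE => /orP[/eqP->|xV] xk; first by move: zk; rewrite (negPf xk).
    have [xsz|xsz] := eqVneq x (s z).
      by move: xk szk; rewrite xsz => /negPf->.
    by rewrite -[x]sK; apply: sI; rewrite !inE tV xV s_eqC xsz.
  move: two => /(two_indepP e_irr)[a [b [c [d [sub eab ecd]]]]] /=.
  rewrite !inE !negb_or => /and4P[/and3P[_ ac ad] /andP[bc bd] _ _].
  have [aW bW cW dW] : [/\ a \in z |: ~: V, b \in z |: ~: V, c \in z |: ~: V & d \in z |: ~: V].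
    by split; apply: sub; rewrite !inE eqxx ?orbT.
  have [ka|ka] := eqVneq a k; last have [kb|kb] := eqVneq b k.
  - by apply: (nI c d) => //; apply: inI => //; rewrite -ka eq_sym.
  - by apply: (nI c d) => //; apply: inI => //; rewrite -kb eq_sym.
  - by apply: (nI a b) => //; apply: inI.
have [zI|zI] := boolP (z \in I); first by apply: (key (s z)); rewrite ?zI ?eqxx ?orbT.
by apply: (key z); rewrite ?eqxx // tI zI orbT.
Qed.

(** A vertex [x] of [V] off the triangle is isolated in [V], so [x] and [s x] are cross-adjacent to
    all other edges of the matching. If [x] were in [I], so would be the triangle; with [s v] in
    [I], all of [V] is excluded and [I] contains the edges of the complement. *)
Lemma triangle_type_no_indep (V I : {set T}) : 4 <= #|V| -> half_set V -> triangle_type V ->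
  half_set I -> independent I -> False.
Proof.
move=> V4 tV [[a [b [c [/and3P[aV bV cV] /and3P[eab ebc eac] tri]]]] two] tI iI.
have [v vV vabc] : exists2 v, v \in V & v \notin [set a; b; c].
  apply/exists_inP; apply: contraT => none; suff : #|V| <= 3 by rewrite leqNgt V4.
  apply: (@leq_trans #|[set a; b; c]|).
    apply/subset_leq_card/subsetP=> x xV; apply: contraT => xabc.
    by case/negP: none; apply/existsP; exists x; rewrite xV.
  by rewrite setUC cardsU1 cards2; case: (a != b); case: (c \notin _).
have isol x t : x \in V -> x \notin [set a; b; c] -> t \in V -> t != x ->
    e x (s t) /\ e (s x) t.
  move=> xV xabc t_V tx; apply: link_cross; rewrite 1?eq_sym //.
    by rewrite eq_sym; apply: (half_set_neq tV).
  by apply: contra xabc => ext; case/andP: (tri x t xV t_V ext).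
have isolI x : x \in V -> x \notin [set a; b; c] -> x \notin I.
  move=> xV xabc; apply/negP=> xI.
  have inI t : t \in V -> t != x -> t \in I.
    move=> t_V tx; have [ext _] := isol x t xV xabc t_V tx.
    by rewrite -[_ \in I]negbK -tI; apply: contraL ext; apply: iI.
  have xa : a != x by apply: contraNneq xabc => <-; rewrite !inE eqxx.
  have xb : b != x by apply: contraNneq xabc => <-; rewrite !inE eqxx orbT.
  by move: (iI a b (inI a aV xa) (inI b bV xb)); rewrite eab.
have svI : s v \in I by rewrite tI isolI.
have disj x : x \in V -> x \notin I.
  move=> xV; have [xabc|] := boolP (x \in [set a; b; c]); last exact: isolI.
  have xv : x != v by apply: contraTneq xabc => ->.
  have [_ esvx] := isol v x vV vabc xV xv.
  by apply: contraL esvx => xI; apply: iI.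
have /(two_indepP e_irr)[x [y [_' [d [sub exy _ _]]]]] := two.
have inI t : t \in ~: V -> t \in I.
  by rewrite inE -tV => stV; rewrite -[_ \in I]negbK -tI disj.
have [xV yV] : x \in ~: V /\ y \in ~: V.
  by split; apply: sub; rewrite !inE eqxx ?orbT.
by move: (iI x y (inI x xV) (inI y yV)); rewrite exy.
Qed.

(** If [x y] does not extend, the partners [s x] and [s y] are two vertices left over, and their
    left side is an independent half set. *)
Lemma edge_extends x y : e x y ->
  (forall I, half_set I -> independent I -> False) -> extends_edge x y.
Proof.
move=> exy noI.
have [/existsP[M /andP[pM xyM]]|none] :=
  boolP [exists M : {set {set T}}, perfect_matching e M && ([set x; y] \in M)].
  by exists M.
have NE L : paired e ([:: x; y] ++ L) -> uniq ([:: x; y] ++ L) ->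
    (forall t, t \in [:: x; y] ++ L) -> False.
  move=> pL uL aL; case/negP: none; apply/existsP; exists [set A in pairsets ([:: x; y] ++ L)].
  by rewrite (pairsets_perfect pL uL aL) inE mem_head.
have pX : paired e [:: x; y] by rewrite /= exy.
have [yE|ysx] := eqVneq y (s x).
  have u : uniq (canon ([::] ++ [:: x])) by rewrite uniq_canon_cons.
  have N : unmatchable [:: x] [::].
    by apply: (nonext_unmatchable u) pX NE; rewrite yE.
  by case: (N [::] [::] u).
have u : uniq (canon ([:: s x; s y] ++ [::])).
  rewrite -[_ ++ _]/[:: s x; s y] !uniq_canon_cons mem_canon !inE !s_eq s_eqC.
  by rewrite negb_or (edge_neq e_irr exy) -s_eqC eq_sym ysx.
have N : unmatchable [::] [:: s x; s y].
  by apply: (nonext_unmatchable u) pX NE; perm_count.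
have tV : half_set (sel [:: s x; s y] (s x)).
  by apply: sel_half_set => // t tD; case: (two_left u N tD).
have inV t : (t \in sel [:: s x; s y] (s x)) = left_side [::] (s x) (s y) t.
  by rewrite (sel_left_side (D' := [::]) (z := s y)) // !inE.
case: (noI _ tV) => t t' tV' tV''; apply: (left_side_indep u N).
  by rewrite -(inV t).
by rewrite -(inV t').
Qed.

(** * Counting: the structures contradict 2-extendability *)

Lemma partner_card t (I W : {set T}) a b c d : involutive t -> t a = b -> t c = d ->
  {subset [:: a; b; c; d] <= W} -> uniq [:: a; b; c; d] ->
  {in I, forall x, x \notin W} -> {in I, forall x, t x \in W} -> #|I| + 4 <= #|W|.
Proof.
move=> tK ab cd sub u dis tI.
have sX : [set x in [:: a; b; c; d]] \subset W.
  by apply/subsetP=> x; rewrite inE; apply: sub.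
have cX : #|[set x in [:: a; b; c; d]]| = 4 by rewrite cardsE (card_uniqP u).
(* [t] permutes the four vertices, which lie in [W], so no vertex outside [W] is matched to them. *)
have sD : t @: I \subset W :\: [set x in [:: a; b; c; d]].
  apply/subsetP=> _ /imsetP[x xI ->]; rewrite in_setD tI // andbT.
  apply: contra (dis x xI) => txX; apply: sub; move: txX.
  rewrite -ab -cd !inE !(inj_eq (inv_inj tK)) ![t _ == _](inv_eq tK).
  by case/or4P=> ->; rewrite ?orbT.
have := subset_leq_card sD; rewrite (card_imset _ (inv_inj tK)) cardsD (setIidPr sX) cX.
by have := subset_leq_card sX; rewrite cX; lia.
Qed.

Definition extends_pair a b c d :=
  exists M, [/\ perfect_matching e M, [set a; b] \in M & [set c; d] \in M].

Lemma extends_pair_partner a b c d : extends_pair a b c d -> exists t,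
  [/\ involutive t, forall x, e x (t x), t a = b & t c = d].
Proof.
case=> M [/(perfect_matching_partner e_sym e_irr)[t [tK et Mt _]]].
by rewrite !Mt => /eqP-> /eqP->; exists t.
Qed.

(** With [#|V| = n], the n - 1 vertices of [V :\ z] need partners in [z |: ~: V], of which only (n +
    1) - 4 are available. *)
Lemma star_type_nonext V z : half_set V -> star_type V z ->
  exists a b c d, [/\ e a b, e c d, uniq [:: a; b; c; d] & ~ extends_pair a b c d].
Proof.
move=> tV [zV iV /(two_indepP e_irr)[a [b [c [d [sub eab ecd u]]]]] _ _].
exists a, b, c, d; split=> // /extends_pair_partner[t [tK et tab tcd]].
have : #|V :\ z| + 4 <= #|z |: ~: V|.
  apply: (partner_card tK tab tcd sub u) => x xV.
    by move: xV; rewrite !inE negb_or negbK.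
  have := contraTN (iV x (t x) xV) (et x).
  by rewrite !inE negb_and negbK.
rewrite cardsU1 inE zV card_half_set //= (cardsD1 z V) zV; lia.
Qed.

(** At least n - 2 vertices of [V] need partners in the complement, of which only n - 4 are
    available. *)
Lemma triangle_type_nonext V : half_set V -> triangle_type V ->
  exists a b c d, [/\ e a b, e c d, uniq [:: a; b; c; d] & ~ extends_pair a b c d].
Proof.
move=> tV [[p [q [r [_ _ tri]]]] /(two_indepP e_irr)[a [b [c [d [sub eab ecd u]]]]]].
exists a, b, c, d; split=> // /extends_pair_partner[t [tK et tab tcd]].
(* [t] has at most one edge inside [V], since two disjoint edges do not fit into a triangle; [x] is
   an end of it. *)
have [x xP] : exists x, {in V :\: [set x; t x], forall y, t y \notin V}.
  have [/existsP[x /andP[xV txV]]|none] := boolP [exists x, (x \in V) && (t x \in V)].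
    exists x => y; rewrite !inE negb_or => /andP[/andP[yx ytx] yV]; apply/negP=> tyV.
    have u4 : uniq [:: x; t x; y; t y].
      have xty : x != t y by rewrite eq_sym (inv_eq tK).
      rewrite /= !inE !negb_or (inj_eq (inv_inj tK)) xty.
      by rewrite (eq_sym x y) (eq_sym (t x) y) yx ytx !(edge_neq e_irr (et _)).
    have sub4 : {subset [:: x; t x; y; t y] <= [:: p; q; r]}.
      have [xp txp] := andP (tri x (t x) xV txV (et x)).
      have [yp typ] := andP (tri y (t y) yV tyV (et y)).
      have in3 w : w \in [set p; q; r] -> w \in [:: p; q; r] by rewrite !inE -orbA.
      by move=> w; rewrite !in_cons in_nil orbF => /or4P[] /eqP->; apply: in3.
    by have := uniq_leq_size u4 sub4.
  (* If [t] has no edge inside [V], any vertex does, since discarding up to two vertices still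
     leaves enough for the count. *)
  exists a => y /setDP[yV _]; apply: contra none => tyV.
  by apply/existsP; exists y; rewrite yV.
have : #|V :\: [set x; t x]| + 4 <= #|~: V|.
  apply: (partner_card tK tab tcd sub u) => y yV; last by rewrite inE xP.
  by rewrite inE negbK; case/setDP: yV.
rewrite card_half_set // cardsD.
have : #|V :&: [set x; t x]| <= 2.
  by rewrite (leq_trans (subset_leq_card (subsetIr _ _))) // cards2; case: (_ != _).
have := subset_leq_card (subsetIl V [set x; t x]); lia.
Qed.

End Dense.

(** * Extendability in terms of vertices; forcing numbers and 4-cycles *)

Section Extendability.
Variables (T : finType) (e : rel T).
Hypotheses (e_sym : symmetric e) (e_irr : irreflexive e).

Lemma extendable1P : connected_graph e -> 4 <= #|T| -> has_perfect_matching e ->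
  extendable e 1 <-> forall x y, e x y -> extends_edge e x y.
Proof.
move=> con T4 pm; rewrite /extendable con T4 pm /=; split=> [/forallP H x y exy|H].
  have m1 : matching e [set [set x; y]].
    have := @pairsets_matching _ e [:: x; y]; rewrite /= exy inE (edge_neq e_irr exy).
    by move=> /(_ isT isT); congr matching; apply/setP=> A; rewrite !inE.
  move/implyP: (H [set [set x; y]]); rewrite m1 cards1 => /(_ isT) /existsP[M /andP[pM]].
  by rewrite sub1set; exists M.
apply/forallP=> M; apply/implyP=> /andP[mM /eqP /(matching1P e_irr mM)[a [b [-> eab _]]]].
by have [M' pM' abM] := H a b eab; apply/existsP; exists M'; rewrite pM' sub1set.
Qed.

Lemma extendable2P : connected_graph e -> 6 <= #|T| -> has_perfect_matching e ->
  extendable e 2 <-> forall a b c d, e a b -> e c d -> uniq [:: a; b; c; d] ->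
                       extends_pair e a b c d.
Proof.
move=> con T6 pm; rewrite /extendable con T6 pm /=.
split=> [/forallP H a b c d eab ecd u|H].
  have [m2 c2] := two_indep_matching eab ecd u.
  move/implyP: (H [set [set a; b]; [set c; d]]); rewrite m2 c2 => /(_ isT).
  by case/existsP=> M /andP[pM]; rewrite subUset !sub1set => /andP[? ?]; exists M.
apply/forallP=> M; apply/implyP=> /andP[mM /eqP].
case/(matching2P e_irr mM)=> a [b [c [d [-> eab ecd u]]]].
have [M' [pM' abM cdM]] := H a b c d eab ecd u.
by apply/existsP; exists M'; rewrite pM' subUset !sub1set abM.
Qed.

Lemma bigmin_leq (I : eqType) (r : seq I) (P : pred I) (F : I -> nat) k i :
  i \in r -> P i -> \big[minn/k]_(j <- r | P j) F j <= F i.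
Proof.
elim: r => // j r IH; rewrite inE big_cons => /orP[/eqP<- ->|ir Pi].
  exact: geq_minl.
by case: ifP => _; [rewrite geq_min IH ?orbT | apply: IH].
Qed.

Lemma fnum_leq (M S : {set {set T}}) : forcing e M S -> fnum e M <= #|S|.
Proof. by move=> fS; apply: bigmin_leq; rewrite ?mem_index_enum. Qed.

(* If the edges of [M] at [x] and [y] span no alternating 4-cycle, then the
   other edges of [M] form a forcing set. *)
Lemma fnum_link (M : {set {set T}}) (s : T -> T) : perfect_matching e M ->
  involutive s -> (forall x, e x (s x)) ->
  (forall x y, ([set x; y] \in M) = (y == s x)) -> M = [set [set x; s x] | x : T] ->
  #|M|.-1 <= fnum e M ->
  forall x y, x != y -> x != s y -> (e x y && e (s x) (s y)) || (e x (s y) && e (s x) y).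
Proof.
move=> pM sK es Ms ME fM x y xy xsy; apply: contraT; rewrite negb_or => /andP[n1 n2].
have sinj := inv_inj sK.
have sx : s x != x by rewrite eq_sym; apply: (edge_neq e_irr).
have nxy : [set x; s x] != [set y; s y].
  by apply/eqP=> /setP/(_ x); rewrite !inE eqxx (negPf xy) (negPf xsy).
pose S := M :\ [set x; s x] :\ [set y; s y].
have cS : #|S|.+2 = #|M|.
  by rewrite (cardsD1 [set x; s x] M) Ms eqxx (cardsD1 [set y; s y] (M :\ _)) !inE Ms eqxx eq_sym nxy.
have fS : forcing e M S; last by move: fM; rewrite -cS ltnNge (fnum_leq fS).
rewrite /forcing (subset_trans (subsetDl _ _) (subsetDl _ _)) /=.
apply/forallP=> M'; apply/implyP=> /andP[pM' /subsetP SM'].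
have [t [tK et Mt M'E]] := perfect_matching_partner e_sym e_irr pM'.
pose Q := [:: x; s x; y; s y].
have out z : z \notin Q -> t z = s z.
  rewrite !inE !negb_or => /and4P[zx zsx zy zsy]; apply/esym/eqP; rewrite -Mt.
  apply: SM'; rewrite !inE Ms eqxx andbT; apply/andP; split; apply/eqP=> /setP/(_ z).
    by rewrite !inE eqxx (negPf zy) (negPf zsy).
  by rewrite !inE eqxx (negPf zx) (negPf zsx).
have sQ z : (s z \in Q) = (z \in Q).
  rewrite !inE !(inj_eq sinj) ![s z == _](inv_eq sK).
  by do 4!case: (z == _).
have tQ z : z \in Q -> t z \in Q.
  by apply: contraLR => tz; rewrite -[z]tK (out _ tz) sQ.
(* [t] acts on the four vertices of [Q]; any pairing other than that of [s] would be one of the two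
   excluded rematchings. *)
have tsx : t x = s x.
  have : t x \in Q by apply: tQ; rewrite mem_head.
  have : t (s x) \in Q by apply: tQ; rewrite !inE eqxx orbT.
  have txx : t x != x by rewrite eq_sym; apply: (edge_neq e_irr).
  have tsx' : t (s x) != s x by rewrite eq_sym; apply: (edge_neq e_irr).
  have neq := inj_eq (inv_inj tK) x (s x).
  rewrite !inE (negPf txx) (negPf tsx') /= => tsxQ /or3P[/eqP//|/eqP txE|/eqP txE].
    case/or3P: tsxQ => /eqP tsxE.
    - by rewrite -[in LHS]tsxE tK.
    - by move: neq; rewrite txE tsxE eqxx eq_sym (negPf sx).
    - by case/negP: n1; rewrite -{1}txE et -tsxE et.
  case/or3P: tsxQ => /eqP tsxE.
  - by rewrite -[in LHS]tsxE tK.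
  - by case/negP: n2; rewrite -{1}txE et -tsxE et.
  - by move: neq; rewrite txE tsxE eqxx eq_sym (negPf sx).
have tsy : t y = s y.
  have : t y \in Q by apply: tQ; rewrite !inE eqxx !orbT.
  have tyy : t y != y by rewrite eq_sym; apply: (edge_neq e_irr).
  have tyx : t y != x by rewrite (inv_eq tK) tsx -(inv_eq sK) eq_sym.
  have tysx : t y != s x by rewrite -tsx (inj_eq (inv_inj tK)) eq_sym.
  by rewrite !inE (negPf tyy) (negPf tyx) (negPf tysx) => /eqP.
rewrite M'E ME; apply/eqP/eq_imset => z; congr [set _; _].
have [|/out//] := boolP (z \in Q).
by rewrite !inE => /or4P[] /eqP->; rewrite ?sK // -?tsx -?tsy tK.
Qed.

End Extendability.

(** * Passing between half sets and labellings *)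

Lemma half_set_labelling (T : finType) (s : T -> T) (V : {set T}) z n :
  involutive s -> half_set s V -> z \in V -> #|V| = n -> exists u v : nat -> T,
  [/\ [set [set u (val i); v (val i)] | i : 'I_n] = [set [set x; s x] | x : T],
      [set u (val i) | i : 'I_n] = ~: V /\ [set v (val i) | i : 'I_n] = V,
      v (n - 1) = z /\ u (n - 1) = s z,
      (forall i, i < n - 1 -> v i \in V :\ z) &
      (forall x, x \in V :\ z -> exists2 i, i < n - 1 & v i = x)].
Proof.
move=> sK tV zV cV; have cVz : size (enum (V :\ z)) = n - 1.
  by rewrite -cardE -cV (cardsD1 z V) zV addKn.
have n1 : (n - 1).+1 = n by rewrite -cV (cardsD1 z V) zV addKn.
pose l := rcons (enum (V :\ z)) z; pose v := nth z l.
have szl : size l = n by rewrite size_rcons cVz n1.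
have meml x : (x \in l) = (x \in V).
  by rewrite mem_rcons inE mem_enum !inE; case: eqVneq => [->|].
have vlast : v (n - 1) = z by rewrite /v nth_rcons cVz ltnn eqxx.
have vi i : i < n - 1 -> v i \in V :\ z.
  by move=> ilt; rewrite /v nth_rcons cVz ilt -mem_enum mem_nth ?cVz.
have vsurj x : x \in V :\ z -> exists2 i, i < n - 1 & v i = x.
  rewrite -mem_enum => xV; exists (index x (enum (V :\ z))).
    by rewrite -cVz index_mem.
  by rewrite /v nth_rcons index_mem xV nth_index.
have vV : [set v (val i) | i : 'I_n] = V.
  apply/setP=> x; rewrite -meml; apply/imsetP/idP => [[i _ ->]|xl].
    by rewrite mem_nth // szl ltn_ord.
  have xn : index x l < n by rewrite -szl index_mem.
  by exists (Ordinal xn); rewrite //= /v nth_index.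
exists (s \o v), v; split=> //.
- apply/setP=> A; apply/imsetP/imsetP => [[i _ ->]|[x _ ->]].
    by exists (v i); rewrite //= setUC.
  have [xV|xV] := boolP (x \in V).
    by move: (xV); rewrite -{1}vV => /imsetP[i _ xE]; exists i; rewrite //= xE setUC.
  have : s x \in V by rewrite tV.
  by rewrite -vV => /imsetP[i _ xE]; exists i; rewrite //= -xE sK.
- split=> //; rewrite -(half_set_imset sK tV) -[in RHS]vV -imset_comp.
  by apply: eq_imset.
- by rewrite /= vlast.
Qed.

(** Injectivity of the labelling is not assumed: the images of [u] and [v] have at most n elements
    each and together cover 2n vertices, so they are disjoint of size n. *)
Lemma labelling_half_set (T : finType) (s : T -> T) (u v : nat -> T) n :
  involutive s -> 0 < n -> #|T| = 2 * n ->
  [set [set u (val i); v (val i)] | i : 'I_n] = [set [set x; s x] | x : T] ->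
  (forall x, s x != x) ->
  let V := [set v (val i) | i : 'I_n] in
  [/\ half_set s V, [set u (val i) | i : 'I_n] = ~: V, #|V| = n,
      s (v (n - 1)) = u (n - 1) &
      forall x, x \in V :\ v (n - 1) <-> exists2 i, i < n - 1 & v i = x].
Proof.
move=> sK n0 cT MM sx V; set U := [set u (val i) | i : 'I_n].
have sv i : i < n -> s (v i) = u i.
  move=> ilt; have : [set u i; v i] \in [set [set x; s x] | x : T].
    by rewrite -MM; apply/imsetP; exists (Ordinal ilt).
  case/imsetP=> x _ E; have : u i \in [set x; s x] by rewrite -E set21.
  have : v i \in [set x; s x] by rewrite -E set22.
  have [xi sxi] : x \in [set u i; v i] /\ s x \in [set u i; v i] by rewrite E set21 set22.
  move: xi sxi; rewrite !inE => + + /orP[]/eqP vE /orP[]/eqP uE; rewrite vE uE // ?orbb.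
  - by rewrite (negPf (sx x)).
  - by rewrite eq_sym (negPf (sx x)).
have UV : U :|: V = setT.
  apply/setP=> x; rewrite !inE.
  have : [set x; s x] \in [set [set u (val i); v (val i)] | i : 'I_n].
    by rewrite MM; apply: imset_f.
  case/imsetP=> i _ /setP/(_ x); rewrite !inE eqxx => /esym/orP[]/eqP->; apply/orP.
    by left; apply: imset_f.
  by right; apply: imset_f.
have leU : #|U| <= n by rewrite -[n in _ <= n]card_ord leq_imset_card.
have leV : #|V| <= n by rewrite -[n in _ <= n]card_ord leq_imset_card.
have cUV : #|U| + #|V| = 2 * n + #|U :&: V| by rewrite -cardsUI UV cardsT cT.
have cV : #|V| = n by lia.
have UVC : U = ~: V.
  have /eqP : #|U :&: V| = 0 by lia.
  rewrite cards_eq0 => /eqP/setP dis; apply/setP=> x.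
  move/setP/(_ x): UV; move: (dis x); rewrite !inE.
  by case: (x \in U) (x \in V) => [] [].
have sU x : x \in V -> s x \in U.
  by case/imsetP=> i _ ->; rewrite (sv _ (ltn_ord i)); apply/imsetP; exists i.
have sV x : x \in U -> s x \in V.
  by case/imsetP=> i _ ->; rewrite -(sv _ (ltn_ord i)) sK; apply/imsetP; exists i.
have ln : n - 1 < n by lia.
split=> //; last 2 first.
- exact: sv.
- have vinj : {in 'I_n &, injective (fun i : 'I_n => v (val i))}.
    by apply/imset_injP; rewrite -/V cV card_ord.
  move=> x; split=> [/setD1P[xl /imsetP[i _ xE]]|[i ilt <-]].
    exists (val i) => //; rewrite ltn_neqAle; apply/andP; split; last by rewrite -ltnS subn1 prednK // ltn_ord.
    by apply: contraNneq xl => <-; rewrite xE.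
  have iltn : i < n by lia.
  apply/setD1P; split; last by apply/imsetP; exists (Ordinal iltn).
  apply/eqP=> vE; have := vinj (Ordinal iltn) (Ordinal ln) isT isT vE.
  by move/(congr1 val) => /=; lia.
- move=> x; have [xV|xV] := boolP (x \in V) => /=.
    by apply/negbTE; have := sU x xV; rewrite UVC inE.
  by apply: sV; rewrite UVC inE.
Qed.

Lemma triangle_type_setC (T : finType) (e : rel T) (U V : {set T}) : U = ~: V ->
  triangle_type e V <->
  (exists a b c : T,
     [/\ [&& a \in V, b \in V & c \in V],
         [&& e a b, e b c & e a c] &
         forall x y : T, x \in V -> y \in V -> e x y ->
           (x \in [set a; b; c]) && (y \in [set a; b; c])]) /\
  two_indep_edges e U.
Proof. by move=> ->. Qed.

(** * Assembling the equivalence *)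

Lemma eq_bigmax_fnum (T : finType) (e : rel T) : has_perfect_matching e ->
  exists2 M, perfect_matching e M & fnum e M = Fnum e.
Proof.
case/existsP=> M0 pM0; rewrite /Fnum.
have [|M pM FM] := @eq_bigmax_cond _ (perfect_matching e) (fnum e); last by exists M; rewrite // -FM.
by apply/card_gt0P; exists M0.
Qed.

Lemma two_indep_card (T : finType) (e : rel T) (W : {set T}) :
  irreflexive e -> two_indep_edges e W -> 4 <= #|W|.
Proof.
move=> e_irr /(two_indepP e_irr)[a [b [c [d [sub _ _ u]]]]].
rewrite -(card_uniqP u : #|[:: a; b; c; d]| = 4).
by apply/subset_leq_card/subsetP.
Qed.

Unset Implicit Arguments.

(* Vertices u_1..u_n, v_1..v_n are u 0..u (n-1), v 0..v (n-1). *)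
Theorem theorem4p1 (T : finType) (e : rel T)
  (esym : symmetric e) (eirr : irreflexive e) (n : nat) :
  3 <= n -> #|T| = 2 * n -> has_perfect_matching e -> Fnum e = n - 1 ->
  (extendable e 1 /\ ~~ extendable e 2 <->
   exists (u v : nat -> T) (M : {set {set T}}),
     [/\ M = [set [set u (val i); v (val i)] | i : 'I_n],
         perfect_matching e M,
         fnum e M = n - 1 &
         let U := [set u (val i) | i : 'I_n] in
         let V := [set v (val i) | i : 'I_n] in
         (* (i) *)
         (4 <= n /\
          (exists a b c : T,
             [/\ [&& a \in V, b \in V & c \in V],
                 [&& e a b, e b c & e a c] &
                 forall x y : T, x \in V -> y \in V -> e x y ->
                   (x \in [set a; b; c]) && (y \in [set a; b; c])]) /\
          two_indep_edges e U)
         \/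
         (* (ii) *)
         ((forall i j : nat, i < n - 1 -> j < n - 1 -> ~~ e (v i) (v j)) /\
          two_indep_edges e (v (n - 1) |: U) /\
          exists i j : nat, [/\ i < n - 1, j < n - 1,
                                e (v i) (v (n - 1)) & e (v j) (u (n - 1))])]).
Proof.
move=> n3 cT pm Fn.
have T6 : 6 <= #|T| by rewrite cT; lia.
have T4 : 4 <= #|T| by rewrite cT; lia.
have dense M : perfect_matching e M -> fnum e M = n - 1 -> exists s : T -> T,
    [/\ involutive s, forall x, e x (s x), M = [set [set x; s x] | x : T] &
        forall x y, x != y -> x != s y ->
          (e x y && e (s x) (s y)) || (e x (s y) && e (s x) y)].
  move=> pM fM; have [s [sK es Ms ME]] := perfect_matching_partner esym eirr pM.
  exists s; split=> //; apply: (fnum_link esym eirr pM) => //.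
  by rewrite fM; have := card_perfect_matching eirr pM; lia.
split=> [[ex1 nex2]|[u [v [M [MM pM fM cases]]]]].
- have [M pM fM] := eq_bigmax_fnum pm; rewrite Fn in fM.
  have [s [sK es ME link]] := dense M pM fM.
  have con := connected_dense esym es link.
  have /(extendable1P eirr con T4 pm) ext := ex1.
  have [V [tV VP]] : exists V, half_set s V /\
      (triangle_type e V \/ exists z, star_type e s V z).
    have [/existsP[a /existsP[b /existsP[c /existsP[d]]]]|none] :=
      boolP [exists a, exists b, exists c, exists d,
        [&& e a b, e c d, uniq [:: a; b; c; d] &
         ~~ [exists M', [&& perfect_matching e M', [set a; b] \in M' & [set c; d] \in M']]]].
      case/and4P=> eab ecd uX /existsPn nM.
      apply: (nonext_pair_good esym eirr sK es link ext eab ecd uX) => L pL uL aL.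
      move: (nM [set A in pairsets ([:: a; b; c; d] ++ L)]).
      by rewrite (pairsets_perfect pL uL aL) !inE !eqxx orbT.
    case/negP: nex2; apply/(extendable2P eirr con T6 pm) => a b c d eab ecd uX.
    move/existsPn/(_ a)/existsPn/(_ b)/existsPn/(_ c)/existsPn/(_ d): none.
    by rewrite eab ecd uX negbK => /existsP[M' /and3P[? ? ?]]; exists M'.
  have cV : #|V| = n.
    by have := card_half_set sK tV; have := cardsC V; rewrite cT; lia.
  (* The labelling needs a last vertex in the triangle case too; any vertex of [V] will do. *)
  have [z zV zP] : exists2 z, z \in V & triangle_type e V \/ star_type e s V z.
    case: VP => [tr|[z st]]; last by exists z; [case: st | right].
    by case: (tr) => -[a [b [c [/andP[aV _] _ _]]]] _; exists a; [|left].
  have [u [v [MM [UE VE] [vz uz] vV vsurj]]] := half_set_labelling sK tV zV cV.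
  exists u, v, M; split=> //; first by rewrite MM.
  move=> U V'; have -> : V' = V by []; have -> : U = ~: V by [].
  case: zP => [[tr two]|[_ iV two [_ /vsurj[i ilt <-] eiz] [_ /vsurj[j jlt <-] ejz]]].
    (* The bound on n comes from the four ends of the independent edges in the complement, which has
       n vertices. *)
    left; split=> //; rewrite -cV -(card_half_set sK tV).
    exact: two_indep_card two.
  right; split=> [i' j' /vV iV' /vV jV'|]; first exact: iV.
  by split; [rewrite vz | exists i, j; rewrite vz uz].
- have [s [sK es ME link]] := dense M pM fM.
  have con := connected_dense esym es link.
  have sx x : s x != x by rewrite eq_sym; apply: (edge_neq eirr).
  have n0 : 0 < n by lia.
  rewrite MM in ME.
  have [tV UE cV sv vP] := labelling_half_set sK n0 cT ME sx.
  move: cases; set V := [set v (val i) | i : 'I_n] => /= cases.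
  (* Either condition yields the two facts needed: the absence of independent half sets makes every
     edge extend, and some pair of disjoint edges does not extend. *)
  have [noI [a [b [c [d [eab ecd uX nX]]]]]] :
      (forall I, half_set s I -> independent e I -> False) /\
      (exists a b c d, [/\ e a b, e c d, uniq [:: a; b; c; d] & ~ extends_pair e a b c d]).
    case: cases => [[n4 tr]|[iV [two [i [j [ilt jlt eiz ejz]]]]]].
      have {}tr := (triangle_type_setC e UE).2 tr.
      split; last exact: (triangle_type_nonext esym eirr sK tV tr).
      by move=> I; apply: (triangle_type_no_indep eirr link _ tV tr); rewrite cV.
    have st : star_type e s V (v (n - 1)).
      split.
      - have nlt : n - 1 < n by lia.
        by apply/imsetP; exists (Ordinal nlt).
      - by move=> x y /vP[k klt <-] /vP[l llt <-]; apply: iV.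
      - by rewrite -UE.
      - by exists (v i) => //; apply/vP; exists i.
      - by exists (v j); [apply/vP; exists j | rewrite sv].
    split; last exact: (star_type_nonext esym eirr sK tV st).
    by move=> I; apply: (star_type_no_indep eirr sK link tV st).
  split.
    apply/(extendable1P eirr con T4 pm) => x y exy.
    exact: (edge_extends eirr sK es link exy noI).
  by apply/negP=> /(extendable2P eirr con T6 pm) H; apply/nX/H.
Qed.
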